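(* Let $F=\mathbb{F}_{q^n}(x,y)$ be the linearized function field defined by $L(y)=f(x)/g(x)$ as in the context, and consider the divisor $G:=\sum_{i=1}^s a_iQ_i+b_\infty Q_\infty$ of $F$, where $a_1,\ldots,a_s,b_\infty\in\mathbb{Z}$. Then the dimension of $\mathcal{L}(G)$ over $\mathbb{F}_{q^n}$ is $$\ell(G)=\sum_{k=0}^{q^r-1}\max\left\{\sum_{i=1}^s\left\lfloor\frac{a_i-kn_i}{q^r}\right\rfloor\deg p_i+\left\lfloor\frac{b_\infty-kd}{q^r}\right\rfloor+1,\;0\right\},$$ with $d=\deg f-\deg g$.
   Context: A linearized function field is a function field $F=\mathbb{F}_{q^n}(x,y)$, with $x$ transcendental over $\mathbb{F}_{q^n}$, defined by an equation $L(y)=h(x):=\frac{f(x)}{g(x)}$, where $L(y)=\sum_{i=0}^r\lambda_iy^{q^i}\in\mathbb{F}_{q^n}[y]$ is a linearized polynomial with $\lambda_r,\lambda_0\neq0$ having $q^r$ roots in $\mathbb{F}_{q^n}$, and $f,g\in\mathbb{F}_{q^n}[x]$ are coprime polynomials whose factorizations into (pairwise distinct) irreducibles are $f=\prod_{j=1}^m q_j^{m_j}$ and $g=\prod_{i=1}^s p_i^{n_i}$. It is assumed that $d:=\deg f-\deg g>0$ and that the positive integers $n_1,\ldots,n_s$ and $d$ are each coprime to the characteristic of $\mathbb{F}_q$. The zeros $P_1,\ldots,P_s$ of $p_1,\ldots,p_s$ and the pole $P_\infty$ of $x$ in $\mathbb{F}_{q^n}(x)$ are totally ramified in $F/\mathbb{F}_{q^n}(x)$.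 $Q_i$ denotes the only zero of $p_i$ in $F$ ($1\leq i\leq s$) and $Q_\infty$ the only pole of $x$ in $F$. For a divisor $G$ of $F$, $\mathcal{L}(G)=\{z\in F\setminus\{0\} : (z)\geq-G\}\cup\{0\}$ is the Riemann--Roch space and $\ell(G)=\dim_{\mathbb{F}_{q^n}}\mathcal{L}(G)$. *)

(* Defs.v *)
From HB Require Import structures.
From mathcomp Require Import all_boot all_order all_algebra.
From mathcomp Require Import boolp classical_sets.
From mathcomp Require Import freeg.

Set Implicit Arguments.
Unset Strict Implicit.
Unset Printing Implicit Defensive.

Import Order.TTheory GRing.Theory Num.Theory.
Local Open Scope ring_scope.

Definition linearized_poly (K : nzRingType) (q r : nat) (lam : 'I_r.+1 -> K) :
    {poly K} :=
  \sum_(i < r.+1) lam i *: 'X^(q ^ i).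

Section FunctionField.
Variables (K F : fieldType) (iota : {rmorphism K -> F}).

(* F is the smallest subfield of F containing K, x and y: F = K(x, y). *)
Definition generated_by2 (x y : F) : Prop :=
  forall S : {pred F}, divring_closed S -> (forall c, iota c \in S) ->
    x \in S -> y \in S -> forall z, z \in S.

(* A place of F/K, given by its normalized discrete valuation (surjective onto
   the integers, trivial on K). The value at 0, mathematically +oo, is fixed to
   the dummy 0, so that equal valuations are equal places; no property of the
   valuation involves it. *)
Record place := Place {
  place_val :> F -> int;
  place_val0 : place_val 0 = 0;
  place_valM : forall a b, a != 0 -> b != 0 ->
    place_val (a * b) = place_val a + place_val b;
  place_valD : forall a b, a != 0 -> b != 0 -> a + b != 0 ->
    Num.min (place_val a) (place_val b) <= place_val (a + b);
  place_val_const : forall c, c != 0 -> place_val (iota c) = 0;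
  place_val_uniformizer : exists t, place_val t = 1
}.

HB.instance Definition _ := gen_eqMixin place.
HB.instance Definition _ := gen_choiceMixin place.

Definition zero_of (P : place) (z : F) : Prop := z != 0 /\ 0 < P z.
Definition pole_of (P : place) (z : F) : Prop := z != 0 /\ P z < 0.

(* The divisors of F/K are the elements of {freeg place / int}; the coefficient
   at P of the principal divisor (z) is P z, so (z) >= - G reads as below. *)
Definition riemann_roch (G : {freeg place / int}) : set F :=
  ([set z | z != 0 /\ forall P : place, - coeff P G <= P z] `|` [set 0])%classic.

(* V is a K-subspace of F with a basis of N elements. *)
Definition has_dim (V : set F) (N : nat) : Prop :=
  exists b : 'I_N -> F,
    (forall c : 'I_N -> K, \sum_i iota (c i) * b i = 0 -> forall i, c i = 0) /\
    (forall z, V z <-> exists c : 'I_N -> K, z = \sum_i iota (c i) * b i).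

End FunctionField.

(* Main.v *)
From HB Require Import structures.
Require Import Defs.
From mathcomp Require Import all_boot all_order all_algebra all_field.
From mathcomp Require Import boolp classical_sets.
From mathcomp Require Import freeg.
From mathcomp Require Import ring lra zify.

Set Implicit Arguments.
Unset Strict Implicit.
Unset Printing Implicit Defensive.

Import Order.TTheory GRing.Theory Num.Theory.
Local Open Scope ring_scope.

(** Write [N = q^r] and [L(y) = f(x)/g(x)] for the equation of [F].

    At the pole of [x] and at the zeros of the [p_i], the value of [L(y)] is
    negative, so the top term of [L] dominates and [N v(y) = v(f/g)]. Since [d]
    and the [n_i] are prime to [N], the terms of a sum [c_0 + c_1 y + .. +
    c_(N-1) y^(N-1)] with [c_k] in [K(x)] have pairwise distinct values there:
    nothing cancels, and the value of the sum is the minimum of the values of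
    its terms ([ramified_val_sum]). It follows that [1, y, .., y^(N-1)] are
    independent over [K(x)], that these places are totally ramified with
    [v(y) = -d], resp. [v(y) = -n_i], and that each of them is the only place
    above its restriction to [K(x)] ([total_ramification],
    [ramified_place_unique]).

    So at [Q_1, .., Q_s] and [Q_inf] the condition [v(z) >= -v(G)] can be
    tested on each term [c_k y^k] separately. It remains to see that this holds
    as well at all other places, where the condition is integrality: if [z] has
    no pole above a prime [pi] of [K[x]] other than the [p_i], then no [c_k] has
    a pole at [pi] ([place_over_factor]). Take a root [x0] of [pi]. Then
    [L(Y) - f(x0)/g(x0)] has a nonzero constant derivative, hence [N] distinct
    roots in a finite extension. A nonzero polynomial of degree less than [N],
    namely the numerator of [z] specialized at [x0], does not vanish at some
    root [y0]. The point [(x0, y0)] is smooth, so Hensel's lemma expands [y] as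
    a power series in [x - x0], and the order of vanishing of such expansions
    is a place of [F] above [pi] ([place_at_point]). The numerator of [z] has
    value [0] there, so the denominator of [z] cannot be divisible by [pi].

    Consequently [z] lies in the Riemann-Roch space of [G] exactly when
    [z = sum_k y^k prod_i p_i(x)^(- alpha_(k,i)) B_k(x)] with
    [alpha_(k,i) = floor((a_i - k n_i)/N)] and [B_k] in [K[x]] whose degree is
    at most [sum_i alpha_(k,i) deg p_i + floor((b - k d)/N)], the last
    condition coming from [Q_inf] ([riemann_roch_expansion], [val_ge_basis]).
    Counting the coefficients of the [B_k] gives the formula. *)

(** * Valuations of sums *)

Section PlaceValuation.
Variables (K F : fieldType) (iota : {rmorphism K -> F}).
Implicit Types (P : place iota) (u v z : F).

Lemma place_val1 P : P 1 = 0.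
Proof. by rewrite -(rmorph1 iota) place_val_const ?oner_neq0. Qed.

Lemma place_valN P z : P (- z) = P z.
Proof.
have [->|z0] := eqVneq z 0; first by rewrite oppr0.
have N1 : iota (-1) = -1 by rewrite rmorphN1.
rewrite -mulN1r place_valM ?oppr_eq0 ?oner_neq0 //.
by rewrite -N1 place_val_const ?add0r // oppr_eq0 oner_neq0.
Qed.

Lemma place_valV P z : P z^-1 = - P z.
Proof.
have [->|z0] := eqVneq z 0; first by rewrite invr0 place_val0 oppr0.
have := place_val1 P; rewrite -(divff z0) place_valM ?invr_eq0 //; lia.
Qed.

Lemma place_val_div P u v : u != 0 -> v != 0 -> P (u / v) = P u - P v.
Proof. by move=> u0 v0; rewrite place_valM ?invr_eq0 // place_valV. Qed.

Lemma place_valX P z n : P (z ^+ n) = n%:Z * P z.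
Proof.
have [->|z0] := eqVneq z 0.
  rewrite expr0n place_val0 mulr0; case: n => [|n] /=; last exact: place_val0.
  exact: place_val1.
elim: n => [|n IH]; first by rewrite expr0 place_val1 mul0r.
rewrite exprS place_valM ?expf_neq0 // IH; lia.
Qed.

Lemma place_valXz P z (n : int) : P (z ^ n) = n * P z.
Proof.
case: n => n; first by rewrite -exprnP place_valX.
by rewrite NegzE -exprnN place_valV place_valX mulNr.
Qed.

Lemma place_val_prod P (I : eqType) (s : seq I) (u : I -> F) :
  (forall i, u i != 0) -> P (\prod_(i <- s) u i) = \sum_(i <- s) P (u i).
Proof.
move=> u0; elim: s => [|i s IH]; first by rewrite !big_nil place_val1.
rewrite !big_cons place_valM // ?IH //.
by rewrite prodf_seq_neq0; apply/allP => j _; apply/implyP.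
Qed.

(** Membership in the fractional ideal of level [c]; the zero element, whose
    value is a dummy, is let in explicitly. *)
Definition val_ge P (c : int) z := (z == 0) || (c <= P z).

Lemma val_ge0 P c : val_ge P c 0.
Proof. by rewrite /val_ge eqxx. Qed.

Lemma val_geE P c z : z != 0 -> val_ge P c z = (c <= P z).
Proof. by rewrite /val_ge => /negPf->. Qed.

Lemma val_geD P c u v : val_ge P c u -> val_ge P c v -> val_ge P c (u + v).
Proof.
have [->|u0] := eqVneq u 0; first by rewrite add0r.
have [->|v0] := eqVneq v 0; first by rewrite addr0.
have [->|uv0] := eqVneq (u + v) 0; first by rewrite val_ge0.
rewrite !val_geE // => cu cv; apply: le_trans (place_valD P u0 v0 uv0).
by rewrite le_min cu.
Qed.

Lemma val_ge_sum P c (I : Type) (s : seq I) (p : pred I) (u : I -> F) :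
  (forall i, p i -> val_ge P c (u i)) -> val_ge P c (\sum_(i <- s | p i) u i).
Proof.
move=> cu; apply: (big_ind (val_ge P c)) => //; first exact: val_ge0.
exact: val_geD.
Qed.

Lemma val_geM P a b u v : val_ge P a u -> val_ge P b v -> val_ge P (a + b) (u * v).
Proof.
have [->|u0] := eqVneq u 0; first by rewrite mul0r => _ _; exact: val_ge0.
have [->|v0] := eqVneq v 0; first by rewrite mulr0 => _ _; exact: val_ge0.
by rewrite !val_geE ?mulf_neq0 // place_valM // => ? ?; apply: lerD.
Qed.

Lemma val_ge_const P c : val_ge P 0 (iota c).
Proof.
have [->|c0] := eqVneq c 0; first by rewrite rmorph0 val_ge0.
by rewrite val_geE ?fmorph_eq0 // place_val_const.
Qed.

(** Strict triangle inequality: a summand of strictly smallest value decides. *)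
Lemma place_val_addl P u v : u != 0 -> val_ge P (P u + 1) v ->
  u + v != 0 /\ P (u + v) = P u.
Proof.
move=> u0; have [->|v0] := eqVneq v 0; first by rewrite addr0.
rewrite val_geE // => uv.
have uv0 : u + v != 0.
  by apply: contraTneq uv => /addr0_eq <-; rewrite place_valN -ltNge; lia.
split=> //.
have A : P u <= P (u + v) \/ P v <= P (u + v).
  by apply/orP; rewrite -ge_min place_valD.
have B : P (u + v) <= P u \/ P v <= P u.
  apply/orP; rewrite -(place_valN P v) -ge_min -[u in leRHS](addrK v).
  by rewrite place_valD ?oppr_eq0 ?addrK.
lia.
Qed.

Lemma place_val_sum_dominant P (I : finType) (u : I -> F) i0 : u i0 != 0 ->
  (forall i, i != i0 -> u i != 0 -> P (u i0) < P (u i)) ->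
  \sum_i u i != 0 /\ P (\sum_i u i) = P (u i0).
Proof.
move=> u0 lt_u; rewrite (bigD1 i0) //=; apply: place_val_addl => //.
apply: val_ge_sum => i i_i0; have [->|ui] := eqVneq (u i) 0; first exact: val_ge0.
rewrite val_geE //; have := lt_u i i_i0 ui; lia.
Qed.

(** The unique term of smallest value dominates the others, so it cannot be
    cancelled and its value is that of the sum. *)
Lemma place_val_sum_distinct P (I : finType) (u : I -> F) :
  (forall i j, u i != 0 -> u j != 0 -> P (u i) = P (u j) -> i = j) ->
  forall i, u i != 0 ->
  [/\ \sum_i u i != 0, P (\sum_i u i) <= P (u i) &
      exists2 j, u j != 0 & P (\sum_i u i) = P (u j)].
Proof.
move=> inj_u i ui; pose S : pred I := fun j => u j != 0.
have [j uj min_j] := arg_minP (fun j => P (u j)) (ui : S i).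
have [|s0 sE] := @place_val_sum_dominant P I u j uj.
  move=> l lj ul; rewrite lt_neqAle min_j // andbT.
  by apply: contraNneq lj => /inj_u ->.
by split=> //; [rewrite sE; apply: min_j | exists j].
Qed.

Lemma place_eq P P' : (forall z, P z = P' z) -> P = P'.
Proof.
case: P P' => [f f0 fM fD fc fu] [g g0 gM gD gc gu] /= /funext fg.
by subst g; congr Place; exact: Prop_irrelevance.
Qed.

End PlaceValuation.

(** * Evaluation of polynomials at elements of the function field *)

(** Iterating this morphism evaluates bivariate polynomials, seen as polynomials
    in the second variable with coefficients in the first. *)
Section EvalAtDef.
Variables (A : nzRingType) (B : comNzRingType) (phi : {rmorphism A -> B}) (b : B).

Definition eval_at (U : {poly A}) : B := (map_poly phi U).[b].

Lemma eval_at_is_zmod_morphism : zmod_morphism eval_at.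
Proof. exact: (raddfB (horner_eval b \o map_poly phi)). Qed.

Lemma eval_at_is_monoid_morphism : monoid_morphism eval_at.
Proof.
have m := rmorphM (horner_eval b \o map_poly phi).
by split=> //; exact: (rmorph1 (horner_eval b \o map_poly phi)).
Qed.

HB.instance Definition _ :=
  GRing.isZmodMorphism.Build {poly A} B eval_at eval_at_is_zmod_morphism.
HB.instance Definition _ :=
  GRing.isMonoidMorphism.Build {poly A} B eval_at eval_at_is_monoid_morphism.

End EvalAtDef.
Arguments eval_at : simpl never.

Section EvalAt.
Variables (A : nzRingType) (B : comNzRingType) (phi : {rmorphism A -> B}) (b : B).

Lemma eval_atE U : eval_at phi b U = (map_poly phi U).[b].
Proof. by []. Qed.

Lemma eval_atC a : eval_at phi b a%:P = phi a.
Proof. by rewrite eval_atE map_polyC hornerC. Qed.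

Lemma eval_atX : eval_at phi b 'X = b.
Proof. by rewrite eval_atE map_polyX hornerX. Qed.

Lemma eval_at_sum n (U : {poly A}) : (size U <= n)%N ->
  eval_at phi b U = \sum_(k < n) phi U`_k * b ^+ k.
Proof.
move=> Un; rewrite eval_atE (@horner_coef_wide _ n); last first.
  by rewrite (leq_trans _ Un) // size_poly.
by apply: eq_bigr => k _; rewrite coef_map.
Qed.

End EvalAt.

Section PlacesOfTheLine.
Variables (K F : fieldType) (iota : {rmorphism K -> F}) (x : F).
Hypothesis x_transc : ~ algebraicOver iota x.
Implicit Types (P : place iota) (A B : {poly K}).
Local Notation ex := (eval_at iota x).

Lemma eval_transc_neq0 A : A != 0 -> ex A != 0.
Proof.
by move=> A0; apply: contra_notN x_transc => /eqP Ax0; exists A => //; apply/rootP.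
Qed.

(** The leading monomial is the only one of smallest value. *)
Lemma place_val_eval_pole P A : P x < 0 -> A != 0 ->
  P (ex A) = (size A).-1%:Z * P x.
Proof.
move=> Px A0; have x0 : x != 0 by apply: contraTneq Px => ->; rewrite place_val0.
have [n sA] : exists n, size A = n.+1.
  by exists (size A).-1; rewrite prednK // size_poly_gt0.
pose u (i : 'I_n.+1) := iota A`_i * x ^+ i.
have uE i : u i != 0 -> P (u i) = i%:Z * P x.
  rewrite /u mulf_eq0 negb_or => /andP[Ai xi].
  by rewrite place_valM // place_val_const -?(fmorph_eq0 iota) // place_valX add0r.
have un : u ord_max != 0.
  rewrite mulf_neq0 ?expf_neq0 // fmorph_eq0.
  by have := A0; rewrite -lead_coef_eq0 lead_coefE sA.
have [|_ Psum] := @place_val_sum_dominant _ _ _ P _ u ord_max un.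
  move=> i i_max ui; rewrite !uE //=.
  have : (i < n)%N by rewrite ltn_neqAle -ltnS ltn_ord andbT; exact: i_max.
  nia.
by rewrite (@eval_at_sum _ _ iota x n.+1) sA // Psum uE.
Qed.

Lemma val_ge_eval P A : 0 <= P x -> val_ge P 0 (ex A).
Proof.
move=> Px; rewrite (@eval_at_sum _ _ iota x (size A)) //; apply: val_ge_sum => i _.
rewrite -[0](addr0 0) val_geM ?val_ge_const //.
by rewrite /val_ge place_valX mulr_ge0 ?orbT.
Qed.

Lemma place_val_x_ge0 P A : 0 < P (ex A) -> 0 <= P x.
Proof.
move=> PA; have A0 : A != 0.
  by apply: contraTneq PA => ->; rewrite rmorph0 place_val0.
rewrite leNgt; apply: contraTN PA => Px; rewrite place_val_eval_pole // -leNgt; nia.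
Qed.

(** Otherwise a Bezout relation would give the constant [1] a positive value. *)
Lemma place_val_eval_coprime P A B : 0 < P (ex A) -> coprimep A B -> P (ex B) = 0.
Proof.
move=> PA cAB; have Px := place_val_x_ge0 PA.
have A0 : ex A != 0 by apply: contraTneq PA => ->; rewrite place_val0.
have [B0|B0] := eqVneq (ex B) 0; first by rewrite B0 place_val0.
apply/eqP; rewrite eq_le; apply/andP; split; last first.
  by have := val_ge_eval B Px; rewrite val_geE.
rewrite leNgt; apply/negP => PB.
have [[u v] /= uv1] := Bezout_eq1_coprimepP A B cAB.
suff: val_ge P 1 (1 : F) by rewrite val_geE ?oner_neq0 // place_val1.
rewrite -(rmorph1 ex) -uv1 rmorphD !rmorphM; apply: val_geD.
  by rewrite -[1](add0r 1) val_geM ?val_ge_eval ?val_geE.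
by rewrite -[1](add0r 1) val_geM ?val_ge_eval ?val_geE.
Qed.

End PlacesOfTheLine.

Lemma irreducible_factor_out (K : fieldType) (p A : {poly K}) :
  irreducible_poly p -> A != 0 ->
  exists m, exists2 B, A = p ^+ m * B & coprimep p B.
Proof.
move=> p_irr; have [n] := ubnP (size A); elim: n A => // n IH A sA A0.
have [pA|pA] := boolP (p %| A); last first.
  exists 0, A; first by rewrite mul1r.
  by rewrite (irreducible_poly_coprime _ p_irr).
have [B AE] := dvdpP _ _ pA; subst A.
move: A0; rewrite mulf_eq0 negb_or => /andP[B0 p0].
have [|m [C -> cC]] := IH B _ B0.
  move: sA; rewrite size_mul //; have := p_irr.1.
  by move: (size p) (size B) => a b; lia.
by exists m.+1, C => //; rewrite exprSr mulrAC.
Qed.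

(** Here [w] is the multiplicity at [p]: what remains after the powers of [p] are
    taken out is coprime to [p] and has value [0]. It is the same for all places
    above [p], which makes them comparable. *)
Lemma place_val_eval_zero (K F : fieldType) (iota : {rmorphism K -> F}) (x : F)
    (p : {poly K}) : ~ algebraicOver iota x -> irreducible_poly p ->
  exists w : {poly K} -> int, forall (P : place iota) A,
    0 < P (eval_at iota x p) -> A != 0 ->
    P (eval_at iota x A) = w A * P (eval_at iota x p).
Proof.
move=> x_transc p_irr; suff /choice : forall A, exists m : int,
    forall P : place iota, 0 < P (eval_at iota x p) -> A != 0 ->
    P (eval_at iota x A) = m * P (eval_at iota x p).
  by move=> [w wE]; exists w => P A; apply: wE.
move=> A; have [->|A0] := eqVneq A 0; first by exists 0 => P _ /eqP[].
have [m [B AE cB]] := irreducible_factor_out p_irr A0.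
exists m => P Pp _; move: A0; rewrite AE mulf_eq0 negb_or => /andP[pm B0].
rewrite rmorphM place_valM ?eval_transc_neq0 // rmorphXn place_valX.
by rewrite (place_val_eval_coprime Pp cB) addr0.
Qed.

Lemma irreducible_factor (K : fieldType) (D : {poly K}) : (1 < size D)%N ->
  exists2 pi, irreducible_poly pi & pi %| D.
Proof.
have [n] := ubnP (size D); elim: n D => // n IH D sD D1.
have [D_irr|D_red] := pselect (irreducible_poly D); first by exists D.
have [A [A1 AD nAD]] : exists A : {poly K}, [/\ size A != 1%N, A %| D & ~~ (A %= D)].
  apply: contra_notP D_red => noA; split=> // A A1 AD.
  by apply: contraT => nAD; case: noA; exists A.
have D0 : D != 0 by rewrite -size_poly_gt0; lia.
have A0 : A != 0 by apply: contraTneq AD => ->; rewrite dvd0p.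
have sAD : (size A < size D)%N.
  by rewrite ltn_neqAle dvdp_leq // andbT dvdp_size_eqp.
have [||pi pi_irr piA] := IH A.
- by rewrite (leq_trans sAD).
- by have := size_poly_gt0 A; rewrite A0; move: A1; case: (size A) => [|[]].
by exists pi => //; exact: dvdp_trans piA AD.
Qed.

(** * Totally ramified places *)

Section TotallyRamified.
Variables (K F : fieldType) (iota : {rmorphism K -> F}) (x y : F).
Variables (N delta : nat) (P : place iota) (e : int).
Hypotheses (e_gt0 : 0 < e) (N_gt0 : (0 < N)%N) (cop : coprime N delta).
Hypothesis Py : N%:Z * P y = - (delta%:Z * e).
Hypothesis y0 : y != 0.

(** The values [e * i + k * P y] with [0 <= k < N] are pairwise distinct: after
    multiplication by [N / e], they read off [k * delta] modulo [N]. *)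
Lemma ramified_val_inj (k l : 'I_N) (c c' : F) : c != 0 -> c' != 0 ->
  (e %| P c)%Z -> (e %| P c')%Z ->
  P (c * y ^+ k) = P (c' * y ^+ l) -> k = l.
Proof.
move=> c0 c0' /dvdzP[a Pc] /dvdzP[a' Pc'].
rewrite !place_valM ?expf_neq0 // !place_valX Pc Pc' => E.
have {}E : (k%:Z - l%:Z) * delta%:Z = N%:Z * (a - a').
  apply: (mulIf (lt0r_neq0 e_gt0)).
  have : N%:Z * (a * e + k%:Z * P y) = N%:Z * (a' * e + l%:Z * P y) by rewrite E.
  rewrite !mulrDr ![N%:Z * (_ * P y)]mulrCA Py => {}E; lra.
have : (N%:Z %| (k%:Z - l%:Z) * delta%:Z)%Z by rewrite E dvdz_mulr.
rewrite Gauss_dvdzl; last by rewrite /coprimez /gcdz; apply/eqP; rewrite (eqP cop).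
have := ltn_ord k; have := ltn_ord l => ? ? /dvdzP[b bE].
have b0 : b = 0 by nia.
by apply: val_inj => /=; move: bE; rewrite b0; lia.
Qed.

(** At a totally ramified place this reduces a condition on the value of a
    polynomial expression in [y] to conditions on its terms. *)
Lemma ramified_val_sum (c : 'I_N -> F) :
    (forall k, c k != 0 -> (e %| P (c k))%Z) ->
  forall k, c k != 0 ->
  [/\ \sum_i c i * y ^+ i != 0, P (\sum_i c i * y ^+ i) <= P (c k * y ^+ k) &
      exists2 j, c j != 0 & P (\sum_i c i * y ^+ i) = P (c j * y ^+ j)].
Proof.
move=> c_e k ck.
have nz j : (c j * y ^+ j != 0) = (c j != 0).
  by rewrite mulf_eq0 expf_eq0 (negPf y0) andbF orbF.
have [||s0 le_s [j]] := @place_val_sum_distinct _ _ _ P _ (fun i => c i * y ^+ i) _ k.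
- move=> i j; rewrite !nz => ci cj. apply: ramified_val_inj => //; exact: c_e.
- by rewrite nz.
by rewrite nz => cj sE; split=> //; exists j.
Qed.

Hypothesis x_transc : ~ algebraicOver iota x.
Hypothesis P_ex : forall A, A != 0 -> (e %| P (eval_at iota x A))%Z.

Lemma ramified_eval2_neq0 (U : {poly {poly K}}) : (size U <= N)%N -> U != 0 ->
  eval_at (eval_at iota x) y U != 0.
Proof.
move=> UN U0; rewrite (eval_at_sum _ _ UN).
have lt_N : ((size U).-1 < N)%N by rewrite prednK ?size_poly_gt0.
have c_e (k : 'I_N) : eval_at iota x U`_k != 0 -> (e %| P (eval_at iota x U`_k))%Z.
  by move=> ck; apply: P_ex; apply: contraNneq ck => ->; rewrite rmorph0.
have [] // := @ramified_val_sum (fun i : 'I_N => eval_at iota x U`_i) c_e (Ordinal lt_N).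
by rewrite eval_transc_neq0 // -lead_coefE lead_coef_eq0.
Qed.

End TotallyRamified.

(** * Polynomial representation of the elements of K(x, y) *)

Section PolynomialRepresentation.
Variables (K F : fieldType) (iota : {rmorphism K -> F}) (x y : F).
Hypothesis x_transc : ~ algebraicOver iota x.
Local Notation ex := (eval_at iota x).
Local Notation exy := (eval_at ex y).
Variables (N : nat) (Lam : {poly {poly K}}).
Hypothesis size_Lam : size Lam = N.+1.
Hypothesis Lam_root : exy Lam = 0.
Hypothesis free_powers :
  forall U : {poly {poly K}}, (size U <= N)%N -> U != 0 -> exy U != 0.

Let Lam_neq0 : Lam != 0.
Proof. by rewrite -size_poly_gt0 size_Lam. Qed.

Lemma eval2Z (D : {poly K}) (U : {poly {poly K}}) : exy (D *: U) = ex D * exy U.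
Proof. by rewrite -mul_polyC rmorphM /= eval_atC. Qed.

(** Pseudo-division by [Lam]; denominators in [K[x]] are the price for [Lam]
    not being monic. *)
Lemma pseudo_reduce (U : {poly {poly K}}) : exists D (V W : {poly {poly K}}),
  [/\ D != 0, (size V <= N)%N & D *: U = W * Lam + V].
Proof.
exists (lead_coef Lam ^+ scalp U Lam), (modp U Lam), (divp U Lam); split.
- by rewrite expf_neq0 // lead_coef_eq0.
- by rewrite -ltnS -size_Lam Pdiv.Idomain.ltn_modp.
exact: Pdiv.Idomain.divp_eq.
Qed.

(** [Lam] generates the ideal of relations between [x] and [y] up to
    denominators, hence any polynomial not vanishing at [(x, y)] is coprime to
    it, and a Bezout relation inverts its value. *)
Lemma eval2_inverse (U : {poly {poly K}}) : exy U != 0 ->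
  exists D V, D != 0 /\ exy V * exy U = ex D.
Proof.
move=> U0; set G := gcdp U Lam.
have [[c H] /= c0 GLam] := Pdiv.Idomain.dvdpP _ _ (Pdiv.Idomain.dvdp_gcdr U Lam).
have [[c' H'] /= c'0 GU] := Pdiv.Idomain.dvdpP _ _ (Pdiv.Idomain.dvdp_gcdl U Lam).
rewrite -/G in GLam GU.
have G0 : exy G != 0.
  apply/eqP => G0; have /eqP := congr1 exy GU.
  rewrite eval2Z rmorphM /= G0 mulr0 mulf_eq0 (negPf U0) orbF.
  by rewrite (negPf (eval_transc_neq0 x_transc c'0)).
have H0 : exy H = 0.
  have /eqP := congr1 exy GLam; rewrite eval2Z rmorphM /= Lam_root mulr0 eq_sym.
  by rewrite mulf_eq0 (negPf G0) orbF => /eqP.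
have Hn0 : H != 0.
  apply/eqP => HE; have /eqP := GLam.
  by rewrite HE mul0r -size_poly_eq0 size_scale // size_Lam.
have Gn0 : G != 0 by apply: contraNneq G0 => ->; rewrite rmorph0.
have sH : (N < size H)%N.
  by rewrite ltnNge; apply/negP => sH; have := free_powers sH Hn0; rewrite H0 eqxx.
have sG : size G = 1%N.
  have := congr1 (fun p : {poly {poly K}} => size p) GLam.
  rewrite /= size_scale // size_mul // size_Lam => E.
  by move: sH Gn0 E; rewrite -size_poly_gt0; move: (size H) (size G) => a b; lia.
have /size_poly1P[g g0 Gg] : size G == 1%N by rewrite sG.
have [[u v] /= uv] := Pdiv.Idomain.Bezoutp U Lam.
have [[c1 c2] /= /andP[c10 c20] cE] := Pdiv.Idomain.eqpP _ _ uv.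
exists (c2 * g), (c1 *: u); split; first by rewrite mulf_neq0.
rewrite eval2Z -mulrA rmorphM /=.
move: (congr1 exy cE); rewrite !eval2Z -/G Gg eval_atC => <-.
by rewrite rmorphD !rmorphM /= Lam_root mulr0 addr0.
Qed.

Hypothesis F_gen : generated_by2 iota x y.

Lemma eval2_surj z : exists D (U : {poly {poly K}}),
  [/\ D != 0, (size U <= N)%N & z * ex D = exy U].
Proof.
pose S := [pred z : F | `[< exists D U, D != 0 /\ z * ex D = exy U >]].
have SP t : reflect (exists D U, D != 0 /\ t * ex D = exy U) (t \in S).
  by apply: (iffP idP) => /asboolP.
suff /SP[D [U [D0 zE]]] : z \in S.
  have [D' [V [W [D'0 sV UE]]]] := pseudo_reduce U.
  exists (D * D'), V; split=> //; first by rewrite mulf_neq0.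
  rewrite rmorphM /= mulrA zE mulrC -eval2Z UE rmorphD rmorphM /= Lam_root mulr0.
  by rewrite add0r.
apply: F_gen; rewrite -/S.
- split.
  + by apply/SP; exists 1, 1; rewrite oner_neq0 !rmorph1 mulr1.
  + move=> a b /SP[D [U [D0 aE]]] /SP[D' [U' [D'0 bE]]]; apply/SP.
    exists (D * D'), (D' *: U - D *: U'); rewrite mulf_neq0 //; split=> //.
    by rewrite rmorphB rmorphM /= !eval2Z -aE -bE; ring.
  + move=> a b /SP[D [U [D0 aE]]] /SP[D' [U' [D'0 bE]]]; apply/SP.
    have [b0|b0] := eqVneq b 0.
      by exists 1, 0; rewrite oner_neq0 b0 invr0 mulr0 mul0r rmorph0.
    have D'x := eval_transc_neq0 x_transc D'0.
    have [|D2 [V [D20 VE]]] := @eval2_inverse U'.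
      by rewrite -bE mulf_neq0.
    exists (D * D2), (D' *: (V * U)); rewrite mulf_neq0 //; split=> //.
    by rewrite eval2Z !rmorphM /= -VE -bE -aE; field.
- move=> c; apply/SP; exists 1, c%:P%:P.
  by rewrite oner_neq0 rmorph1 mulr1 eval_atC /= eval_atC.
- by apply/SP; exists 1, 'X%:P; rewrite oner_neq0 rmorph1 mulr1 eval_atC /= eval_atX.
- by apply/SP; exists 1, 'X; rewrite oner_neq0 rmorph1 mulr1 eval_atX.
Qed.

End PolynomialRepresentation.

(** * Places from formal power series *)

Lemma dvdX_horner0 (k : fieldType) (A : {poly k}) : ('X %| A) = (A.[0] == 0).
Proof. by rewrite -(subr0 'X) -polyC0 dvdp_XsubCl. Qed.

(** A power series expansion of the elements of a subring of [F], the image of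
    [rho], is given by its truncations: [c m U] represents the expansion of [U]
    modulo the power [m + 1] of the variable. *)
Section PowerSeriesPlace.
Variables (K F k : fieldType) (iota : {rmorphism K -> F}).
Variables (R : comNzRingType) (rho : {rmorphism R -> F}) (kappa : {rmorphism K -> R}).
Variable c : nat -> {rmorphism R -> {poly k}}.
Hypothesis rho_kappa : forall a, rho (kappa a) = iota a.
Hypothesis rho_surj : forall z, exists U V, rho V != 0 /\ z * rho V = rho U.
Hypothesis c_coherent : forall m (U : R), 'X^(m.+1) %| c m.+1 U - c m U.
Hypothesis c_rho : forall U, (rho U = 0) <-> (forall m, 'X^(m.+1) %| c m U).
Hypothesis c_uniformizer : exists U : R, ('X^1 %| c 1%N U) && ~~ ('X^2 %| c 2%N U).

Let D j U := 'X^j %| c j U.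

Let c_congr j m (U : R) : (j <= m.+1)%N -> ('X^j %| c m U) = D j U.
Proof.
have step i l : (j <= i.+1)%N -> ('X^j %| c (i + l)%N U) = ('X^j %| c i U).
  move=> ji; elim: l => [|l <-]; first by rewrite addn0.
  rewrite addnS -(subrK (c (i + l)%N U) (c (i + l).+1 U)) dvdp_addr //.
  by apply: dvdp_trans (c_coherent (i + l) U); apply: dvdp_exp2l; lia.
move=> jm; rewrite /D; case: (leqP j m) => [jm'|mj].
  by rewrite -(subnKC jm') step.
have jE : j = m.+1 by lia.
by rewrite -(@step m 1%N jm) addn1 -jE.
Qed.

Let D_anti i j U : (i <= j)%N -> D j U -> D i U.
Proof.
move=> ij Dj; rewrite -(@c_congr i j) ?(leqW ij) //.
by apply: dvdp_trans Dj; apply: dvdp_exp2l.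
Qed.

(* The order exists because only the elements of the kernel of [rho] have an
   expansion that vanishes to all orders. *)
Let exists_ord U : exists a, rho U != 0 -> forall j, D j U = (j <= a)%N.
Proof.
have [U0|U0] := eqVneq (rho U) 0; first by exists 0%N => /eqP.
have nD : exists j, ~~ D j U.
  apply: contraPP U0 => allD; apply/negP; rewrite negbK; apply/eqP/c_rho => m.
  by rewrite c_congr //; apply: contra_notT allD => nD; exists m.+1.
exists (ex_minn nD).-1 => _ j; case: ex_minnP => m nDm min_m.
have m0 : (0 < m)%N by rewrite lt0n; apply: contraNneq nDm => ->; rewrite /D dvd1p.
apply/idP/idP => [Dj|jm].
  by rewrite leqNgt; apply: contra nDm => ltj; apply: D_anti Dj; lia.
by apply: contraT => /min_m; lia.
Qed.

(** The order of vanishing along the power series branch [c] is a discrete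
    valuation, and the dictionary below determines it on the image of [R]. *)
Lemma place_of_power_series : exists P : place iota,
  forall j U, rho U != 0 -> ((j%:Z <= P (rho U)) = ('X^j %| c j U)).
Proof.
have [o oP] := choice exists_ord.
have {}oP U : rho U != 0 -> forall j, D j U = (j <= o U)%N by exact: oP.
have D_rho j U V : rho U = rho V -> D j U = D j V.
  move=> UV; have /c_rho/(_ j) : rho (U - V) = 0 by rewrite rmorphB UV subrr.
  move=> dUV; rewrite /D -(subrK V U) rmorphD dvdp_addr //.
  by apply: dvdp_trans dUV; apply: dvdp_exp2l.
have ord_eq U V : rho U != 0 -> rho U = rho V -> o U = o V.
  move=> U0 UV; have V0 : rho V != 0 by rewrite -UV.
  apply/eqP; rewrite eqn_leq; apply/andP; split.
    by rewrite -oP // -(D_rho _ _ _ UV) oP.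
  by rewrite -oP // (D_rho _ _ _ UV) oP.
have ordM U V : rho U != 0 -> rho V != 0 -> o (U * V) = (o U + o V)%N.
  move=> U0 V0; have UV0 : rho (U * V) != 0 by rewrite rmorphM mulf_neq0.
  pose M := (o U + o V).+1.
  have unit_part W : rho W != 0 -> (o W < M)%N ->
      exists2 w, c M W = w * 'X^(o W) & ~~ ('X %| w).
    move=> W0 oM; have : 'X^(o W) %| c M W by rewrite c_congr ?oP; lia.
    case/dvdpP=> w wE; exists w => //; have : ~~ ('X^((o W).+1) %| c M W).
      by rewrite c_congr ?oP //; lia.
    by rewrite wE exprS dvdp_mul2r // expf_neq0 // polyX_eq0.
  have [|u cU uX] := unit_part U U0; first by rewrite /M; lia.
  have [|v cV vX] := unit_part V V0; first by rewrite /M; lia.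
  have cUV : c M (U * V) = u * v * 'X^(o U + o V).
    by rewrite rmorphM cU cV exprD; ring.
  apply/eqP; rewrite eqn_leq -oP // -(@c_congr _ M) /M ?leqW // cUV dvdp_mull // andbT.
  rewrite leqNgt -oP // -(@c_congr _ M) // cUV exprS dvdp_mul2r.
    by move: uX vX; rewrite !dvdX_horner0 hornerM mulf_eq0 negb_or => -> ->.
  by rewrite expf_neq0 // polyX_eq0.
have ordD U V : rho U != 0 -> rho V != 0 -> rho (U + V) != 0 ->
    (o U <= o (U + V)%R)%N || (o V <= o (U + V)%R)%N.
  have DD i : D i U -> D i V -> D i (U + V).
    by rewrite /D rmorphD; exact: dvdp_add.
  move=> U0 V0 UV0; rewrite -!oP //; case: (leqP (o U) (o V)) => le_o.
    by rewrite DD ?oP.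
  by rewrite orbC DD ?oP // ltnW.
have ord_kappa a : a != 0 -> o (kappa a) = 0%N.
  move=> a0; have k0 b : b != 0 -> rho (kappa b) != 0 by rewrite rho_kappa fmorph_eq0.
  have : o (kappa 1) = 0%N.
    apply/eqP; rewrite -leqn0 leqNgt -oP ?k0 ?oner_neq0 // /D rmorph1 rmorph1.
    by rewrite expr1 dvdX_horner0 hornerC oner_neq0.
  by rewrite -(divff a0) rmorphM ordM ?k0 ?invr_eq0 //; lia.
have /choice[num /choice[den numden]] := rho_surj.
have den0 z : rho (den z) != 0 by case: (numden z).
have numE z : z * rho (den z) = rho (num z) by case: (numden z).
have num0 z : z != 0 -> rho (num z) != 0 by move=> z0; rewrite -numE mulf_neq0.
pose v z : int := if z == 0 then 0 else (o (num z))%:Z - (o (den z))%:Z.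
have vE z U V : z != 0 -> rho V != 0 -> z * rho V = rho U ->
    v z = (o U)%:Z - (o V)%:Z.
  move=> z0 V0 zE; have U0 : rho U != 0 by rewrite -zE mulf_neq0.
  rewrite /v (negPf z0); suff : (o (num z) + o V = o U + o (den z))%N by lia.
  rewrite -!ordM ?den0 ?num0 //; apply: ord_eq; first by rewrite rmorphM mulf_neq0 ?num0.
  by rewrite !rmorphM /= -numE -zE; ring.
have v_rho U : rho U != 0 -> v (rho U) = o U.
  move=> U0; rewrite (vE _ U (kappa 1)) //.
  - by rewrite ord_kappa ?oner_neq0 // subr0.
  - by rewrite !rmorph1 oner_neq0.
  by rewrite !rmorph1 mulr1.
have v0 : v 0 = 0 by rewrite /v eqxx.
have vM a b : a != 0 -> b != 0 -> v (a * b) = v a + v b.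
  move=> a0 b0; rewrite (vE _ (num a * num b) (den a * den b)) ?mulf_neq0 //.
  - by rewrite /v (negPf a0) (negPf b0) !ordM ?num0 ?den0 //; lia.
  - by rewrite rmorphM mulf_neq0 ?den0.
  by rewrite !rmorphM /= -!numE; ring.
have vD a b : a != 0 -> b != 0 -> a + b != 0 -> Num.min (v a) (v b) <= v (a + b).
  move=> a0 b0 ab0; pose A := num a * den b; pose B := num b * den a.
  have dab0 : rho (den a * den b) != 0 by rewrite rmorphM mulf_neq0 ?den0.
  have abE : (a + b) * rho (den a * den b) = rho (A + B).
    by rewrite rmorphD !rmorphM /= -!numE; ring.
  rewrite (vE (a + b) (A + B) (den a * den b)) //.
  rewrite (vE a A (den a * den b)) //; last by rewrite !rmorphM /= -numE; ring.
  rewrite (vE b B (den a * den b)) //; last by rewrite !rmorphM /= -numE; ring.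
  have A0 : rho A != 0 by rewrite rmorphM mulf_neq0 ?num0 ?den0.
  have B0 : rho B != 0 by rewrite rmorphM mulf_neq0 ?num0 ?den0.
  rewrite ge_min !lerD2r; apply: ordD => //.
  by rewrite -abE mulf_neq0.
have v_const a : a != 0 -> v (iota a) = 0.
  by move=> a0; rewrite -rho_kappa v_rho ?ord_kappa // rho_kappa fmorph_eq0.
have v_unif : exists t, v t = 1.
  have [U /andP[D1 D2]] := c_uniformizer.
  have U0 : rho U != 0.
    by apply: contra D2 => /eqP /c_rho/(_ 2%N); rewrite c_congr // => /(@D_anti 2); apply.
  exists (rho U); rewrite v_rho //; move: D1 D2; rewrite -!/(D _ _) !oP //; lia.
exists (Place v0 vM vD v_const v_unif) => j U U0 /=.
by rewrite v_rho // lez_nat -oP.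
Qed.

End PowerSeriesPlace.

(** * Hensel lifting over polynomials truncated at powers of the variable *)

Lemma dvdp_horner_sub (k : fieldType) (U : {poly {poly k}}) (d a b : {poly k}) :
  d %| a - b -> d %| U.[a] - U.[b].
Proof.
move=> dab; elim/poly_ind: U => [|U c IH]; first by rewrite !horner0 subr0 dvdp0.
rewrite !hornerMXaddC [X in _ %| X](_ : _ = (U.[a] - U.[b]) * a + U.[b] * (a - b)).
  by apply: dvdp_add; [apply: dvdp_mulr | apply: dvdp_mull].
by ring.
Qed.

Lemma horner_taylor1 (A : comNzRingType) (U : {poly A}) (a h : A) :
  exists t, U.[a + h] = U.[a] + U^`().[a] * h + t * h ^+ 2.
Proof.
elim/poly_ind: U => [|U c [t tE]]; first by exists 0; rewrite deriv0 !horner0; ring.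
exists (U^`().[a] + t * (a + h)).
by rewrite derivMXaddC hornerD !hornerMXaddC hornerMX tE; ring.
Qed.

Section Hensel.
Variables (k : fieldType) (U : {poly {poly k}}) (y0 : k).
Let d0 := (U^`().[y0%:P]).[0].

(** Newton iteration with the derivative frozen at the initial point: each step
    fixes one more coefficient of the root. *)
Fixpoint hensel_seq m : {poly k} :=
  if m is m'.+1 then
    hensel_seq m' - (U.[hensel_seq m']`_m / d0) *: 'X^m
  else y0%:P.

Lemma hensel_seq_coherent m : 'X^(m.+1) %| hensel_seq m.+1 - hensel_seq m.
Proof. by rewrite /= addrAC subrr add0r dvdpNr -mul_polyC dvdp_mull. Qed.

Lemma hensel_seq_init m : 'X %| hensel_seq m - y0%:P.
Proof.
elim: m => [|m IH]; first by rewrite subrr dvdp0.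
rewrite -(subrKA (hensel_seq m)) dvdp_add //.
by apply: dvdp_trans (hensel_seq_coherent m); rewrite exprS dvdp_mulr.
Qed.

Hypothesis d0_neq0 : d0 != 0.
Hypothesis root_y0 : (U.[y0%:P]).[0] = 0.

Lemma hensel_seq_root m : 'X^(m.+1) %| U.[hensel_seq m].
Proof.
elim: m => [|m IH]; first by rewrite expr1 dvdX_horner0 root_y0.
set Y := hensel_seq m in IH *; have [w wE] := dvdpP _ _ IH.
have d0E : (U^`().[Y]).[0] = d0.
  have := dvdp_horner_sub U^`() (hensel_seq_init m).
  by rewrite dvdX_horner0 hornerD hornerN subr_eq0 => /eqP.
have w0 : U.[Y]`_m.+1 = w.[0].
  by rewrite wE coefMXn ltnn subnn horner_coef0.
rewrite /= -/Y w0; set h := - _; have [t ->] := horner_taylor1 U Y h.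
have -> : h = - (w.[0] / d0)%:P * 'X^(m.+1) by rewrite /h -mul_polyC mulNr.
rewrite wE [X in _ %| X](_ : _ = (w - U^`().[Y] * (w.[0] / d0)%:P
  + t * ((w.[0] / d0)%:P ^+ 2) * 'X^(m.+1)) * 'X^(m.+1)); last by ring.
rewrite ['X^(m.+2)]exprS dvdp_mul2r ?expf_neq0 ?polyX_eq0 //.
rewrite dvdX_horner0 !(hornerE, hornerXn) d0E expr0n /= mulr0 addr0.
by rewrite mulrAC divff // mul1r subrr.
Qed.

End Hensel.

(** * Finite fields with enough roots *)

Lemma finField_splitting (K : finFieldType) (A : {poly K}) : A != 0 ->
  exists (L : finFieldType) (j : {rmorphism K -> L}) (rs : seq L),
  map_poly j A %= \prod_(z <- rs) ('X - z%:P).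
Proof.
move=> /FinSplittingFieldFor[L [rs eq_rs _]].
by exists (finvect_type L), (in_alg L), rs.
Qed.

(** * Places at smooth points *)

Section PlaceAtPoint.
Variables (K F : fieldType) (iota : {rmorphism K -> F}) (x y : F).
Hypothesis x_transc : ~ algebraicOver iota x.
Hypothesis F_gen : generated_by2 iota x y.
Local Notation ex := (eval_at iota x).
Local Notation exy := (eval_at ex y).
Variables (N : nat) (Lam : {poly {poly K}}).
Hypothesis size_Lam : size Lam = N.+1.
Hypothesis Lam_root : exy Lam = 0.
Hypothesis free_powers :
  forall U : {poly {poly K}}, (size U <= N)%N -> U != 0 -> exy U != 0.
Variables (L : finFieldType) (j : {rmorphism K -> L}) (x0 y0 : L).
Local Notation ev := (eval_at (eval_at j x0) y0).
Hypothesis Lam_point : ev Lam = 0.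
Hypothesis Lam_smooth : ev Lam^`() != 0.

(** Taylor expansion at [x0]. *)
Let taylor : {rmorphism {poly K} -> {poly L}} := eval_at (polyC \o j) ('X + x0%:P).

Let taylor0 A : (taylor A).[0] = eval_at j x0 A.
Proof.
rewrite /taylor /= (eval_at_sum _ _ (leqnn _)) (eval_at_sum _ _ (leqnn _)).
by rewrite horner_sum; apply: eq_bigr => i _; rewrite !hornerE.
Qed.

Let taylor_size A : size (taylor A) = size A.
Proof.
rewrite /taylor /= /eval_at map_poly_comp -[_.[_]]/(map_poly j A \Po _).
by rewrite size_comp_poly2 ?size_map_poly // size_XaddC.
Qed.

Let Y := hensel_seq (map_poly taylor Lam) y0.
(* Substitution of the truncated branch [(x0 + X, Y)] through the point. *)
Let c m : {rmorphism {poly {poly K}} -> {poly L}} := eval_at taylor (Y m).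

Let c_point (Z : {poly L}) U : (eval_at taylor Z U).[0] = eval_at (eval_at j x0) Z.[0] U.
Proof.
rewrite (eval_at_sum _ _ (leqnn _)) (eval_at_sum _ _ (leqnn _)).
by rewrite horner_sum; apply: eq_bigr => i _; rewrite !hornerE taylor0.
Qed.

Let c_coherent m U : 'X^(m.+1) %| c m.+1 U - c m U.
Proof. exact: dvdp_horner_sub (hensel_seq_coherent _ _ _). Qed.

Let c_le i m U : (i <= m)%N -> 'X^(i.+1) %| c m U - c i U.
Proof.
move=> /subnKC <-; elim: (m - i)%N => [|l IH]; first by rewrite addn0 subrr dvdp0.
rewrite addnS -(subrKA (c (i + l)%N U)) dvdp_add //.
by apply: dvdp_trans (c_coherent _ _); apply: dvdp_exp2l; lia.
Qed.

Let c_Lam m : 'X^(m.+1) %| c m Lam.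
Proof.
apply: hensel_seq_root.
  by rewrite deriv_map -/(eval_at taylor _ _) c_point hornerC.
by rewrite -/(eval_at taylor _ _) c_point hornerC.
Qed.

Let dvdX_all (A : {poly L}) : (forall m, 'X^(m.+1) %| A) -> A = 0.
Proof.
move=> dA; apply/eqP; apply: contraT => A0.
by have := dvdp_leq A0 (dA (size A)); rewrite size_polyXn => /ltnW; rewrite ltnn.
Qed.

(** A denominator [D] may vanish at [x0]; its order of vanishing is made up for
    by working at a higher precision. *)
Let c_kernel U : exy U = 0 -> forall m, 'X^(m.+1) %| c m U.
Proof.
move=> U0 m; have [D [V [W [D0 sV UE]]]] := pseudo_reduce size_Lam U.
have V0 : V = 0.
  apply/eqP; apply: contraT => /(free_powers sV) /eqP[].
  have := congr1 exy UE; rewrite eval2Z U0 mulr0 rmorphD rmorphM /= Lam_root mulr0.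
  by rewrite add0r.
have tD0 : taylor D != 0 by rewrite -size_poly_gt0 taylor_size size_poly_gt0.
have [l [B BE cB]] : exists l, exists2 B, taylor D = 'X^l * B & coprimep 'X B.
  apply: irreducible_factor_out => //; rewrite -['X]subr0 -polyC0; exact: irredp_XsubC.
have dvd_DU : 'X^((m + l).+1) %| 'X^l * B * c (m + l)%N U.
  have := congr1 (c (m + l)%N) UE.
  rewrite V0 addr0 -mul_polyC !rmorphM /= /c /= eval_atC BE => ->.
  by apply: dvdp_mull; exact: c_Lam.
have dvdU : 'X^(m.+1) %| c (m + l)%N U.
  move: dvd_DU; rewrite -addSn exprD -mulrA [X in _ %| X]mulrC dvdp_mul2r; last first.
    by rewrite expf_neq0 ?polyX_eq0.
  by rewrite Gauss_dvdpr // coprimep_expl.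
by rewrite -(dvdp_subr _ dvdU) c_le ?leq_addr.
Qed.

Let c_rho U : exy U = 0 <-> forall m, 'X^(m.+1) %| c m U.
Proof.
split; first exact: c_kernel.
move=> dU; apply/eqP; apply: contraT => U0.
have [D [V [D0 VE]]] := eval2_inverse x_transc size_Lam Lam_root free_powers U0.
have : taylor D = 0.
  apply: dvdX_all => m.
  have : exy (V * U - D%:P) = 0.
    by rewrite rmorphB rmorphM /= eval_atC /= VE subrr.
  move=> /c_kernel/(_ m); rewrite rmorphB rmorphM /= /c /= eval_atC.
  by rewrite dvdp_subr // dvdp_mull //; exact: dU.
by move=> /eqP; rewrite -size_poly_eq0 taylor_size size_poly_eq0 (negPf D0).
Qed.

(** As [L] is finite, [x0] is a simple root of [X^#|L| - X]. *)
Let c_uniformizer : exists U : {poly {poly K}}, ('X^1 %| c 1%N U) && ~~ ('X^2 %| c 2%N U).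
Proof.
have cE m : c m ('X^#|L| - 'X)%:P = ('X + x0%:P) ^+ #|L| - ('X + x0%:P).
  by rewrite /c /= eval_atC rmorphB rmorphXn /= /taylor /= eval_atX.
exists ('X^#|L| - 'X)%:P; rewrite !cE expr1 dvdX_horner0.
rewrite !hornerE expf_card subrr eqxx /=.
have card0 : #|L|%:R = 0 :> L.
  apply: (addrI (\sum_(a : L) a)); rewrite addr0 [RHS](reindex_inj (addIr 1)).
  by rewrite big_split /= sumr_const.
apply/negP => /dvdpP[w]; move: #|L| card0 => M card0 wE.
have /eqP := congr1 (fun A => (A^`()).[0]) wE.
rewrite derivB deriv_exp derivD derivX derivC addr0 derivM derivXn.
rewrite hornerD hornerN hornerMn.
rewrite -mulr_natl card0 mul0r hornerC sub0r /= expr1.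
by rewrite !(hornerE, hornerMn) /= ?(mul0rn, mulr0, addr0) oppr_eq0 oner_eq0.
Qed.

(** A smooth point of the affine plane curve [Lam = 0] carries a place: [y] is a
    power series in [x - x0] there, and [P] is the order of vanishing. *)
Lemma place_at_point : exists P : place iota,
  forall U, exy U != 0 -> 0 <= P (exy U) /\ (0 < P (exy U)) = (ev U == 0).
Proof.
have rho_surj z : exists U V, exy V != 0 /\ z * exy V = exy U.
  have [D [U [D0 _ zE]]] := eval2_surj x_transc size_Lam Lam_root free_powers F_gen z.
  exists U, D%:P; rewrite eval_atC; split=> //.
  exact: eval_transc_neq0.
have rho_kappa a : exy ((polyC \o polyC) a) = iota a by rewrite /= eval_atC /= eval_atC.
have [P PE] := place_of_power_series rho_kappa rho_surj c_coherent c_rho c_uniformizer.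
exists P => U U0; split; first by have := PE 0%N U U0; rewrite dvd1p.
have -> : (0 < P (exy U)) = (1 <= P (exy U)) by lia.
rewrite (PE 1%N) // expr1 dvdX_horner0 c_point.
have := hensel_seq_init (map_poly taylor Lam) y0 1.
by rewrite dvdX_horner0 hornerD hornerN hornerC subr_eq0 => /eqP ->.
Qed.

End PlaceAtPoint.

(** * Linearized polynomials *)

Section Linearized.
Variables (p e q r : nat) (K : fieldType) (lam : 'I_r.+1 -> K).
Hypotheses (p_prime : prime p) (e_gt0 : (0 < e)%N) (q_def : q = (p ^ e)%N).
Hypothesis lam_r : lam ord_max != 0.
Local Notation L := (linearized_poly q lam).

Let q_gt1 : (1 < q)%N.
Proof. by rewrite q_def -(exp1n e) ltn_exp2r ?prime_gt1. Qed.

Lemma size_linearized : size L = (q ^ r).+1.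
Proof.
rewrite /linearized_poly big_ord_recr /= addrC size_polyDl size_scale //= ?size_polyXn //.
rewrite ltnS (leq_trans (size_sum _ _ _)) //; apply/bigmax_leqP => i _.
by rewrite (leq_trans (size_scale_leq _ _)) // size_polyXn ltn_exp2l.
Qed.

Lemma lead_coef_linearized : lead_coef L = lam ord_max.
Proof.
rewrite lead_coefE size_linearized /= /linearized_poly big_ord_recr /= coefD.
rewrite coefZ coefXn eqxx mulr1 nth_default ?add0r //.
rewrite (leq_trans (size_sum _ _ _)) //; apply/bigmax_leqP => i _.
by rewrite (leq_trans (size_scale_leq _ _)) // size_polyXn ltn_exp2l.
Qed.

(** All exponents but [q^0] are divisible by the characteristic. *)
Lemma deriv_linearized : p \in [pchar K] -> L^`() = (lam ord0)%:P.
Proof.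
move=> charK; rewrite /linearized_poly big_ord_recl /= expn0 derivD derivZ derivX.
rewrite alg_polyC (raddf_sum (@deriv K)) big1 ?addr0 // => i _.
have /eqP q0 : ((q ^ i.+1)%N%:R == 0 :> K).
  rewrite -(dvdn_pcharf charK) q_def -expnM; apply: dvdn_exp (dvdnn p).
  by rewrite muln_gt0 e_gt0.
by rewrite /= derivZ derivXn -scaler_nat q0 scale0r scaler0.
Qed.

Lemma horner_linearized (F : fieldType) (iota : {rmorphism K -> F}) y :
  (map_poly iota L).[y] = \sum_(i < r.+1) iota (lam i) * y ^+ (q ^ i).
Proof.
rewrite /linearized_poly rmorph_sum horner_sum; apply: eq_bigr => i _.
by rewrite /= map_polyZ map_polyXn hornerZ hornerXn.
Qed.

(** At a pole of [y] the top term of [L(y)] is the one of smallest value. *)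
Lemma place_val_linearized_pole (F : fieldType) (iota : {rmorphism K -> F})
    (P : place iota) y : P y < 0 ->
  P (map_poly iota L).[y] = (q ^ r)%N%:Z * P y.
Proof.
move=> Py; have y0 : y != 0 by apply: contraTneq Py => ->; rewrite place_val0.
rewrite horner_linearized.
have uE (i : 'I_r.+1) : iota (lam i) * y ^+ (q ^ i) != 0 ->
    P (iota (lam i) * y ^+ (q ^ i)) = (q ^ i)%N%:Z * P y.
  rewrite mulf_eq0 negb_or => /andP[li _].
  rewrite place_valM ?expf_neq0 // place_val_const -?(fmorph_eq0 iota) //.
  by rewrite place_valX add0r.
have top : iota (lam ord_max) * y ^+ (q ^ r) != 0.
  by rewrite mulf_neq0 ?fmorph_eq0 ?expf_neq0.
have [|_ ->] := @place_val_sum_dominant _ _ _ P _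
    (fun i : 'I_r.+1 => iota (lam i) * y ^+ (q ^ i)) ord_max top.
  move=> i i_max ui; rewrite !uE //=.
  have : (q ^ i < q ^ r)%N.
    rewrite ltn_exp2l // ltn_neqAle -ltnS ltn_ord andbT; exact: i_max.
  nia.
exact: uE top.
Qed.

Lemma val_ge_linearized (F : fieldType) (iota : {rmorphism K -> F})
    (P : place iota) y : val_ge P 0 (map_poly iota L).[y] -> val_ge P 0 y.
Proof.
have [->|y0] := eqVneq y 0; first by rewrite val_ge0.
rewrite (val_geE _ _ y0) leNgt => hL; apply/negP => Py.
have := place_val_linearized_pole Py; move: hL; rewrite /val_ge.
have [->|_ /=] := eqVneq; first by rewrite place_val0 => _; have := expn_gt0 q r; nia.
move=> + E; rewrite E; have := expn_gt0 q r; nia.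
Qed.

End Linearized.

(** * Uniqueness of the totally ramified places *)

Section TotalRamification.
Variables (K F : fieldType) (iota : {rmorphism K -> F}) (x y : F) (N : nat).
Hypothesis x_transc : ~ algebraicOver iota x.
Local Notation ex := (eval_at iota x).
Local Notation exy := (eval_at ex y).
Hypothesis N_gt0 : (0 < N)%N.
Hypothesis y_neq0 : y != 0.
Hypothesis repr : forall z,
  exists D (U : {poly {poly K}}), [/\ D != 0, (size U <= N)%N & z * ex D = exy U].

Lemma ramified_val_eval2 (delta : nat) (P : place iota) (e : int)
    (U : {poly {poly K}}) :
    0 < e -> coprime N delta -> N%:Z * P y = - (delta%:Z * e) ->
    (forall A, A != 0 -> (e %| P (ex A))%Z) -> (size U <= N)%N -> exy U != 0 ->
  (exists2 j, U`_j != 0 & P (exy U) = P (ex U`_j * y ^+ j)) /\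
  (forall j, U`_j != 0 -> P (exy U) <= P (ex U`_j * y ^+ j)).
Proof.
move=> e0 cop Py P_ex UN.
have exn0 (A : {poly K}) : (ex A != 0) = (A != 0).
  apply/idP/idP => [|/(eval_transc_neq0 x_transc)//].
  by apply: contraNneq => ->; rewrite rmorph0.
have c_e (k : 'I_N) : ex U`_k != 0 -> (e %| P (ex U`_k))%Z.
  by rewrite exn0; exact: P_ex.
have sum_min := ramified_val_sum e0 N_gt0 cop Py y_neq0 c_e.
rewrite (eval_at_sum _ _ UN) => U0.
have [k0 Uk0] : exists k : 'I_N, ex U`_k != 0.
  apply/existsP; apply: contraNT U0; rewrite negb_exists => /forallP all0.
  by rewrite big1 // => k _; have /negPn/eqP Uk := all0 k; rewrite [X in X * _]Uk mul0r.
split=> [|j Uj].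
  by have [_ _ [j cj ->]] := sum_min k0 Uk0; exists j; rewrite -?exn0.
have jN : (j < N)%N.
  by rewrite (leq_trans _ UN) // ltnNge; apply: contra Uj => sU; rewrite nth_default.
have exj : ex U`_(Ordinal jN) != 0 by rewrite exn0.
by have [_ le_j _] := sum_min (Ordinal jN) exj.
Qed.

(** [N] divides [e] because [delta] is prime to [N]; conversely the values of
    [K(x)], which are multiples of [e], and that of [y] generate all of the value
    group, and [N] times each of them is divisible by [e]. *)
Lemma total_ramification (delta : nat) (P : place iota) (e : int) :
    0 < e -> coprime N delta -> N%:Z * P y = - (delta%:Z * e) ->
    (forall A, A != 0 -> (e %| P (ex A))%Z) ->
  e = N /\ P y = - delta%:Z.
Proof.
move=> e0 cop Py P_ex; suff eN : e = N.
  split=> //; apply: (@mulfI _ N%:Z); first by move: N_gt0; lia.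
  by rewrite Py eN mulrN mulrC.
have N_e : (N%:Z %| e)%Z.
  have : (N%:Z %| delta%:Z * e)%Z.
    by apply/dvdzP; exists (- P y); rewrite mulNr [P y * _]mulrC Py opprK.
  by rewrite Gauss_dvdzr // /coprimez /gcdz /= (eqP cop).
have e_N : (e %| N%:Z)%Z.
  have [t Pt] := place_val_uniformizer P; have [D [U [D0 UN tE]]] := repr t.
  have t0 : t != 0 by apply: contra_eq_neq Pt => ->; rewrite place_val0.
  have U0 : exy U != 0 by rewrite -tE mulf_neq0 ?eval_transc_neq0.
  have [[j Uj PU] _] := ramified_val_eval2 e0 cop Py P_ex UN U0.
  have /dvdzP[u uE] := P_ex _ D0; have /dvdzP[v vE] := P_ex _ Uj.
  have PE : 1 + u * e = v * e + j%:Z * P y.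
    rewrite -Pt -uE -place_valM ?eval_transc_neq0 // tE PU.
    by rewrite place_valM ?eval_transc_neq0 ?expf_neq0 // place_valX vE.
  apply/dvdzP; exists (v * N%:Z - j%:Z * delta%:Z - u * N%:Z).
  have : N%:Z * (1 + u * e) = N%:Z * (v * e + j%:Z * P y) by rewrite PE.
  rewrite !mulrDr [N%:Z * (j%:Z * _)]mulrCA Py => E; lra.
move/dvdzP: N_e => [u uE]; move/dvdzP: e_N => [v vE].
have u0 : 0 < u by move: N_gt0; nia.
have v0 : 0 < v by move: N_gt0; nia.
have := N_gt0; nia.
Qed.

(** The value of every element is a minimum of terms that are computed from the
    values on [K(x)] and that of [y]. *)
Lemma ramified_place_unique (delta : nat) (P P' : place iota) :
    coprime N delta ->
    (forall A, A != 0 -> P (ex A) = P' (ex A)) ->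
    (forall A, A != 0 -> (N%:Z %| P (ex A))%Z) ->
    P y = - delta%:Z -> P' y = - delta%:Z -> P = P'.
Proof.
move=> cop PP' P_ex Py P'y; apply: place_eq => z.
have [->|z0] := eqVneq z 0; first by rewrite !place_val0.
have [D [U [D0 UN zE]]] := repr z.
have Dx := eval_transc_neq0 x_transc D0.
have U0 : exy U != 0 by rewrite -zE mulf_neq0.
have N0 : 0 < N%:Z by rewrite ltz_nat.
have P'_ex A : A != 0 -> (N%:Z %| P' (ex A))%Z by move=> A0; rewrite -PP' ?P_ex.
have NPy : N%:Z * P y = - (delta%:Z * N%:Z) by rewrite Py mulrN mulrC.
have NP'y : N%:Z * P' y = - (delta%:Z * N%:Z) by rewrite P'y mulrN mulrC.
have [[j Uj PU] min_j] := ramified_val_eval2 N0 cop NPy P_ex UN U0.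
have [[l Ul P'U] min_l] := ramified_val_eval2 N0 cop NP'y P'_ex UN U0.
have termE i : U`_i != 0 -> P (ex U`_i * y ^+ i) = P' (ex U`_i * y ^+ i).
  move=> Ui; rewrite !place_valM ?eval_transc_neq0 ?expf_neq0 //.
  by rewrite !place_valX PP' // Py P'y.
have PUE : P (exy U) = P' (exy U).
  apply/eqP; rewrite eq_le; apply/andP; split.
    by rewrite P'U -termE // min_j.
  by rewrite PU termE // min_l.
apply: (addIr (P (ex D))); rewrite {2}PP' // -!place_valM //.
by rewrite zE.
Qed.

End TotalRamification.

(** * Arithmetic of the linearized function field *)

Section LinearizedFunctionField.
Variables (p e q r : nat) (K : finFieldType) (lam : 'I_r.+1 -> K).
Hypotheses (p_prime : prime p) (e_gt0 : (0 < e)%N) (q_def : q = (p ^ e)%N).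
Hypothesis charK : p \in [pchar K].
Hypotheses (lam_r : lam ord_max != 0) (lam_0 : lam ord0 != 0).
Variables (f g : {poly K}) (s : nat) (pg : 'I_s -> {poly K}) (ng : 'I_s -> nat).
Hypothesis cop_fg : coprimep f g.
Hypothesis pg_irr : forall i, irreducible_poly (pg i).
Hypothesis pg_distinct : forall i1 i2, i1 != i2 -> ~~ (pg i1 %= pg i2).
Hypothesis ng_gt0 : forall i, (0 < ng i)%N.
Hypothesis g_fact : g %= \prod_(i < s) pg i ^+ ng i.
Variable d : nat.
Hypotheses (d_def : d%:Z = (size f).-1%:Z - (size g).-1%:Z) (d_gt0 : (0 < d)%N).
Hypotheses (ng_coprime : forall i, coprime (ng i) p) (d_coprime : coprime d p).
Variables (F : fieldType) (iota : {rmorphism K -> F}) (x y : F).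
Hypothesis x_transc : ~ algebraicOver iota x.
Hypothesis F_gen : generated_by2 iota x y.
Hypothesis y_eq : (map_poly iota (linearized_poly q lam)).[y]
                  = (map_poly iota f).[x] / (map_poly iota g).[x].
Variables (Q : 'I_s -> place iota) (Qinf : place iota).
Hypothesis Q_zero : forall i, zero_of (Q i) (map_poly iota (pg i)).[x].
Hypothesis Qinf_pole : pole_of Qinf x.

Local Notation N := (q ^ r)%N.
Local Notation ex := (eval_at iota x).
Local Notation exy := (eval_at ex y).
Local Notation L := (linearized_poly q lam).

Lemma degree_gt0 : (0 < N)%N.
Proof. by rewrite q_def !expn_gt0 prime_gt0. Qed.

Lemma degreeZ_gt0 : 0 < N%:Z.
Proof. by rewrite ltz_nat degree_gt0. Qed.

Lemma coprime_degree n : coprime n p -> coprime N n.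
Proof. by move=> np; rewrite q_def -expnM coprimeXl // coprime_sym. Qed.

Lemma pg_neq0 i : pg i != 0.
Proof. exact: irredp_neq0 (pg_irr i). Qed.

Lemma g_neq0 : g != 0.
Proof.
have /eqp_size := g_fact; rewrite -size_poly_eq0 => ->; rewrite size_poly_eq0.
by rewrite prodf_seq_neq0; apply/allP => i _; rewrite expf_neq0 ?pg_neq0.
Qed.

Lemma f_neq0 : f != 0.
Proof. by apply: contraTneq d_gt0 => f0; move: d_def; rewrite f0 size_poly0; clear; lia. Qed.

Lemma ex_neq0 A : A != 0 -> ex A != 0.
Proof. exact: eval_transc_neq0. Qed.

Lemma ex_f_div_g : (map_poly iota L).[y] = ex f / ex g.
Proof. exact: y_eq. Qed.

Lemma ex_f_div_g_neq0 : ex f / ex g != 0.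
Proof. by rewrite mulf_neq0 ?invr_eq0 ?ex_neq0 ?f_neq0 ?g_neq0. Qed.

Lemma y_neq0 : y != 0.
Proof.
apply: contraTneq ex_f_div_g_neq0 => y0; rewrite -ex_f_div_g y0 horner_linearized.
rewrite big1 ?eqxx // => i _; rewrite expr0n expn_eq0.
by rewrite eqn0Ngt q_def expn_gt0 prime_gt0 //= mulr0.
Qed.

(** An element [y] that is integral at [P] has an integral [L(y)], so [y] has a
    pole here. *)
Lemma place_val_y_pole (P : place iota) : P (ex f / ex g) < 0 ->
  N%:Z * P y = P (ex f / ex g).
Proof.
move=> Ph; rewrite -ex_f_div_g in Ph *.
have [Py|Py] := ltP (P y) 0.
  by rewrite (place_val_linearized_pole p_prime e_gt0 q_def lam_r Py).
suff : val_ge P 0 (map_poly iota L).[y].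
  by rewrite val_geE ?ex_f_div_g ?ex_f_div_g_neq0 // -ex_f_div_g leNgt Ph.
rewrite horner_linearized; apply: val_ge_sum => i _.
rewrite -[0](addr0 0) val_geM ?val_ge_const //.
by rewrite /val_ge place_valX mulr_ge0 ?orbT.
Qed.

Lemma pg_coprime i j : i != j -> coprimep (pg i) (pg j).
Proof.
move=> ij; rewrite irreducible_poly_coprime //; apply: contra (pg_distinct ij) => dij.
by apply: (pg_irr j).2 => //; rewrite neq_ltn (pg_irr i).1 orbT.
Qed.

Lemma pg_dvd_g i : pg i %| g.
Proof.
rewrite (eqp_dvdr _ g_fact) (bigD1 i) //= dvdp_mulr //.
by rewrite -[X in X %| _]expr1 dvdp_exp2l.
Qed.

Lemma place_val_pg_pg (P : place iota) i j : 0 < P (ex (pg i)) -> i != j ->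
  P (ex (pg j)) = 0.
Proof. by move=> Pi ij; apply: place_val_eval_coprime Pi (pg_coprime ij). Qed.

Lemma place_val_g (P : place iota) :
  P (ex g) = \sum_(i < s) (ng i)%:Z * P (ex (pg i)).
Proof.
have /eqpf_eq[c c0 ->] := g_fact.
have pg_n0 i : ex (pg i ^+ ng i) != 0 by rewrite ex_neq0 // expf_neq0 // pg_neq0.
rewrite -mul_polyC rmorphM rmorph_prod /= eval_atC.
rewrite place_valM ?fmorph_eq0 //; last first.
  by rewrite prodf_seq_neq0; apply/allP => i _; exact: pg_n0.
rewrite place_val_const // add0r place_val_prod //.
by apply: eq_bigr => i _; rewrite rmorphXn place_valX.
Qed.

(** * The totally ramified places of the linearized function field *)

(** The equation of the field, cleared of denominators. *)
Definition curve : {poly {poly K}} := g *: map_poly polyC L - f%:P.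

Lemma size_curve : size curve = N.+1.
Proof.
have sL : size (g *: map_poly polyC L) = N.+1.
  rewrite size_scale ?g_neq0 // size_map_inj_poly ?polyC0 //; last exact: polyC_inj.
  exact: size_linearized p_prime e_gt0 q_def lam_r.
rewrite /curve size_polyDl sL // size_polyN (leq_ltn_trans (size_polyC_leq1 _)) //.
by rewrite ltnS degree_gt0.
Qed.

Lemma eval_const_coefs (B : comNzRingType) (phi : {rmorphism {poly K} -> B}) b :
  eval_at phi b (map_poly polyC L) = (map_poly (phi \o polyC) L).[b].
Proof. by rewrite eval_atE -map_poly_comp. Qed.

Lemma curve_root : exy curve = 0.
Proof.
rewrite rmorphB /= eval_atC -mul_polyC rmorphM /= eval_atC eval_const_coefs.
have -> : map_poly (ex \o polyC) L = map_poly iota L.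
  by apply: eq_map_poly => c /=; rewrite eval_atC.
by rewrite ex_f_div_g mulrCA divff ?ex_neq0 ?g_neq0 // mulr1 subrr.
Qed.

Lemma deriv_curve : curve^`() = (g * (lam ord0)%:P)%:P.
Proof.
rewrite derivB derivC subr0 derivZ deriv_map.
rewrite (deriv_linearized lam e_gt0 q_def) // map_polyC /=.
by rewrite -mul_polyC -polyCM.
Qed.

Lemma place_val_pole_x (P : place iota) : P x < 0 ->
  N%:Z * P y = - (d%:Z * - P x) /\ forall A, A != 0 -> (- P x %| P (ex A))%Z.
Proof.
move=> Px; split=> [|A A0]; last first.
  by rewrite place_val_eval_pole // -mulrNN dvdz_mull.
have hE : P (ex f / ex g) = d%:Z * P x.
  rewrite place_val_div ?ex_neq0 ?f_neq0 ?g_neq0 //.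
  by rewrite !place_val_eval_pole ?f_neq0 ?g_neq0 // d_def mulrBl.
by rewrite place_val_y_pole hE ?mulrN ?opprK // pmulr_rlt0 // ltz_nat.
Qed.

(** One totally ramified place suffices to see that [1, y, .., y^(q^r - 1)] are
    linearly independent over [K(x)]. *)
Lemma free_powers_y (U : {poly {poly K}}) : (size U <= N)%N -> U != 0 -> exy U != 0.
Proof.
have [_ Px] := Qinf_pole; have [Py P_ex] := place_val_pole_x Px.
apply: (@ramified_eval2_neq0 _ _ _ x y N d Qinf (- Qinf x)) => //.
- by rewrite oppr_gt0.
- exact: degree_gt0.
- exact: coprime_degree.
- exact: y_neq0.
Qed.

Lemma representation z : exists D (U : {poly {poly K}}),
  [/\ D != 0, (size U <= N)%N & z * ex D = exy U].
Proof. exact: (eval2_surj x_transc size_curve curve_root free_powers_y F_gen). Qed.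

Lemma pole_x_ramified (P : place iota) : P x < 0 -> P x = - N%:Z /\ P y = - d%:Z.
Proof.
move=> Px; have [Py P_ex] := place_val_pole_x Px.
have := total_ramification x_transc degree_gt0 y_neq0 representation _ _ Py P_ex.
rewrite oppr_gt0 => /(_ Px (coprime_degree d_coprime))[PxN ->].
by split=> //; rewrite -PxN opprK.
Qed.

Lemma pole_x_unique (P : place iota) : P x < 0 -> P = Qinf.
Proof.
move=> Px; have [_ Qx] := Qinf_pole.
have [PxN Py] := pole_x_ramified Px; have [QxN Qy] := pole_x_ramified Qx.
apply: (ramified_place_unique x_transc degree_gt0 y_neq0 representation
  (coprime_degree d_coprime)) => // A A0; rewrite !place_val_eval_pole //.
  by rewrite PxN QxN.
by rewrite PxN mulrN rpredN dvdz_mull.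
Qed.

Lemma zero_pg_val_y (P : place iota) i : 0 < P (ex (pg i)) ->
  N%:Z * P y = - ((ng i)%:Z * P (ex (pg i))).
Proof.
move=> Pi; have hE : P (ex f / ex g) = - ((ng i)%:Z * P (ex (pg i))).
  rewrite place_val_div ?ex_neq0 ?f_neq0 ?g_neq0 //.
  rewrite (place_val_eval_coprime Pi); last first.
    by rewrite coprimep_sym; exact: coprimep_dvdl (pg_dvd_g i) cop_fg.
  rewrite place_val_g (bigD1 i) //= big1 ?addr0 ?sub0r // => j ji.
  by rewrite (place_val_pg_pg Pi) ?mulr0 // eq_sym.
by rewrite place_val_y_pole hE // oppr_lt0 mulr_gt0 // ltz_nat.
Qed.

Lemma zero_pg_ramified (P : place iota) i : 0 < P (ex (pg i)) ->
  P (ex (pg i)) = N /\ P y = - (ng i)%:Z.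
Proof.
move=> Pi; have Py := zero_pg_val_y Pi.
apply: (total_ramification x_transc degree_gt0 y_neq0 representation Pi _ Py).
  exact: coprime_degree (ng_coprime i).
have [w wE] := place_val_eval_zero x_transc (pg_irr i).
by move=> A A0; rewrite (wE P) // dvdz_mull.
Qed.

Lemma zero_pg_unique (P : place iota) i : 0 < P (ex (pg i)) -> P = Q i.
Proof.
move=> Pi; have [_ Qi] := Q_zero i.
have [PiN Py] := zero_pg_ramified Pi; have [QiN Qy] := zero_pg_ramified Qi.
have [w wE] := place_val_eval_zero x_transc (pg_irr i).
apply: (ramified_place_unique x_transc degree_gt0 y_neq0 representation
  (coprime_degree (ng_coprime i))) => // A A0; rewrite (wE P) //.
  by rewrite (wE (Q i)) // PiN QiN.
by rewrite PiN dvdz_mull.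
Qed.

Lemma Q_ramified i : Q i (ex (pg i)) = N /\ Q i y = - (ng i)%:Z.
Proof. exact: zero_pg_ramified (Q_zero i).2. Qed.

Lemma Qinf_ramified : Qinf x = - N%:Z /\ Qinf y = - d%:Z.
Proof. exact: pole_x_ramified Qinf_pole.2. Qed.

Lemma Q_pg i j : Q i (ex (pg j)) = if i == j then N%:Z else 0.
Proof.
have [<-|ij] := eqVneq i j; first exact: (Q_ramified i).1.
exact: place_val_pg_pg (Q_zero i).2 ij.
Qed.

Lemma Q_x i : 0 <= Q i x.
Proof. exact: place_val_x_ge0 (Q_zero i).2. Qed.

Lemma Q_inj i j : (Q i == Q j) = (i == j).
Proof.
apply/eqP/eqP => [Qij|-> //]; have := Q_pg i i; rewrite eqxx Qij Q_pg.
by case: eqVneq => // _ N0; have := degreeZ_gt0; rewrite -N0 ltxx.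
Qed.

Lemma Q_neq_Qinf i : (Q i == Qinf) = false.
Proof. by apply/eqP => QE; have := Q_x i; rewrite QE leNgt Qinf_pole.2. Qed.

(** * Local conditions imposed by the divisor *)

Variables (a : 'I_s -> int) (b : int).

Local Notation G := (\sum_(i < s) << a i *g Q i >> + << b *g Qinf >>
  : {freeg (place iota) / int}).

Definition alpha (k : nat) i : int := ((a i - k%:Z * (ng i)%:Z) %/ N%:Z)%Z.
Definition beta (k : nat) : int := ((b - k%:Z * d%:Z) %/ N%:Z)%Z.
(** One more than the largest degree that a polynomial multiplying
    [scaled_power k] may have at [Qinf]; it can be negative. *)
Definition bound (k : nat) : int :=
  \sum_(i < s) alpha k i * (size (pg i)).-1%:Z + beta k + 1.

(** The monomial of degree [k] in [y], scaled to the best denominators that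
    [G] allows at the finite places. *)
Definition scaled_power (k : nat) : F :=
  y ^+ k * \prod_(i < s) ex (pg i) ^ (- alpha k i).
Local Notation w := scaled_power.

Lemma coeff_G (P : place iota) : coeff P G =
  \sum_(i < s) a i * (Q i == P)%:R + b * (Qinf == P)%:R.
Proof.
rewrite coeffD coeffU (raddf_sum (coeff P)) /=; congr (_ + _).
by apply: eq_bigr => i _; rewrite coeffU.
Qed.

Lemma coeff_G_Q i : coeff (Q i) G = a i.
Proof.
rewrite coeff_G (eq_sym Qinf) Q_neq_Qinf mulr0 addr0 (bigD1 i) //= eqxx mulr1.
by rewrite big1 ?addr0 // => j ji; rewrite Q_inj (negPf ji) mulr0.
Qed.

Lemma coeff_G_Qinf : coeff Qinf G = b.
Proof.
rewrite coeff_G eqxx mulr1 big1 ?add0r // => i _.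
by rewrite Q_neq_Qinf mulr0.
Qed.

Lemma coeff_G_other (P : place iota) :
  0 <= P x -> (forall i, P (ex (pg i)) = 0) -> coeff P G = 0.
Proof.
move=> Px Pg; rewrite coeff_G big1 => [|i _].
  have [QP|_] := eqVneq Qinf P; last by rewrite mulr0 addr0.
  by move: Px; rewrite -QP leNgt Qinf_pole.2.
have [QP|_] := eqVneq; last by rewrite mulr0.
by have := degreeZ_gt0; have := Pg i; rewrite -QP Q_pg eqxx => ->; rewrite ltxx.
Qed.

Lemma place_trichotomy (P : place iota) :
  [\/ P = Qinf, exists i, P = Q i | 0 <= P x /\ forall i, P (ex (pg i)) = 0].
Proof.
have [Px|Px] := ltP (P x) 0; first by constructor 1; exact: pole_x_unique.
have [[i Pi]|Pg] := pselect (exists i, 0 < P (ex (pg i))).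
  by constructor 2; exists i; exact: zero_pg_unique.
constructor 3; split=> // i; apply/eqP; rewrite eq_le leNgt.
have := val_ge_eval (pg i) Px; rewrite val_geE ?ex_neq0 ?pg_neq0 // => ->.
by rewrite andbT; apply/negP => Pi; apply: Pg; exists i.
Qed.

Lemma val_ge_y (P : place iota) : (forall i, P (ex (pg i)) = 0) -> 0 <= P x -> val_ge P 0 y.
Proof.
move=> Pg Px; apply: (val_ge_linearized p_prime e_gt0 q_def lam_r).
rewrite ex_f_div_g val_geE ?ex_f_div_g_neq0 // place_val_div ?ex_neq0 ?f_neq0 ?g_neq0 //.
rewrite place_val_g big1 => [|i _]; last by rewrite Pg mulr0.
by rewrite subr0; have := val_ge_eval f Px; rewrite val_geE ?ex_neq0 ?f_neq0.
Qed.

Lemma prod_pg_neq0 (m : 'I_s -> int) : \prod_(i < s) ex (pg i) ^ m i != 0.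
Proof.
by rewrite prodf_seq_neq0; apply/allP => i _; rewrite expfz_neq0 // ex_neq0 // pg_neq0.
Qed.

Lemma scaled_power_neq0 k : w k != 0.
Proof. by rewrite mulf_neq0 ?prod_pg_neq0 // expf_neq0 // y_neq0. Qed.

Lemma place_val_prod_pg (P : place iota) (m : 'I_s -> int) :
  P (\prod_(i < s) ex (pg i) ^ m i) = \sum_(i < s) m i * P (ex (pg i)).
Proof.
rewrite place_val_prod => [|i]; last by rewrite expfz_neq0 // ex_neq0 // pg_neq0.
by apply: eq_bigr => i _; rewrite place_valXz.
Qed.

Lemma place_val_scaled_power (P : place iota) k :
  P (w k) = k%:Z * P y - \sum_(i < s) alpha k i * P (ex (pg i)).
Proof.
rewrite place_valM ?prod_pg_neq0 ?expf_neq0 ?y_neq0 // place_valX place_val_prod_pg.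
by congr (_ + _); rewrite -sumrN; apply: eq_bigr => i _; rewrite mulNr.
Qed.

Lemma Q_scaled_power i k : Q i (w k) = - (k%:Z * (ng i)%:Z) - alpha k i * N%:Z.
Proof.
rewrite place_val_scaled_power (Q_ramified i).2 mulrN (bigD1 i) //= Q_pg eqxx.
by rewrite big1 ?addr0 // => j ji; rewrite Q_pg eq_sym (negPf ji) mulr0.
Qed.

Lemma Qinf_ex A : A != 0 -> Qinf (ex A) = - ((size A).-1%:Z * N%:Z).
Proof.
move=> A0; rewrite place_val_eval_pole //; last exact: Qinf_pole.2.
by rewrite Qinf_ramified.1 mulrN.
Qed.

Lemma Qinf_scaled_power k :
  Qinf (w k) = - (k%:Z * d%:Z) + (bound k - beta k - 1) * N%:Z.
Proof.
rewrite place_val_scaled_power Qinf_ramified.2 mulrN /bound; congr (_ + _).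
rewrite [X in X * _](_ : _ = \sum_(i < s) alpha k i * (size (pg i)).-1%:Z); last by ring.
rewrite mulr_suml -sumrN; apply: eq_bigr => i _.
by rewrite Qinf_ex ?pg_neq0 // mulrN opprK mulrA.
Qed.

Lemma floorP (m : int) : (m %/ N%:Z)%Z * N%:Z <= m < ((m %/ N%:Z)%Z + 1) * N%:Z.
Proof.
by rewrite lez_floor ?ltz_ceil ?lt0r_neq0 ?degreeZ_gt0.
Qed.

(** The exponents [alpha k i] are rounded down, so the poles at the [Q i] are
    allowed by [G] whatever [B] is; only the pole at [Qinf] restricts [B]. *)
Lemma val_ge_basis k (B : {poly K}) (P : place iota) :
    (size B)%:Z <= Num.max (bound k) 0 ->
  val_ge P (- coeff P G) (w k * ex B).
Proof.
have [->|B0] := eqVneq B 0; first by rewrite rmorph0 mulr0 val_ge0.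
rewrite le_max => sB.
have {}sB : (size B).-1%:Z + 1 <= bound k.
  have := size_poly_gt0 B; rewrite B0; move: sB.
  by move: (size B) (bound k) => t u; clear => /orP[]; lia.
have w0 := scaled_power_neq0 k; have exB := ex_neq0 B0.
rewrite val_geE ?(mulf_neq0 w0 exB) // place_valM //.
case: (place_trichotomy P) => [->|[i ->]|[Px Pg]].
- rewrite coeff_G_Qinf Qinf_scaled_power Qinf_ex //.
  have /andP[] := floorP (b - k%:Z * d%:Z); rewrite -/(beta k).
  have : 0 <= (bound k - ((size B).-1%:Z + 1)) * N%:Z by rewrite mulr_ge0 // subr_ge0.
  move: (bound k) (beta k) (size B).-1%:Z N%:Z => u v t M; clear; lia.
- rewrite coeff_G_Q Q_scaled_power.
  have := val_ge_eval B (Q_x i); rewrite val_geE ?ex_neq0 //.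
  have /andP[] := floorP (a i - k%:Z * (ng i)%:Z); rewrite -/(alpha k i).
  move: (Q i _) (alpha k i) N%:Z (k%:Z * _) => u v M t; clear; lia.
rewrite coeff_G_other // oppr0 place_val_scaled_power big1 => [|i _]; last first.
  by rewrite Pg mulr0.
have := val_ge_eval B Px; rewrite val_geE ?ex_neq0 //.
have := val_ge_y Pg Px; rewrite val_geE ?y_neq0 // => Py PB.
by rewrite subr0 addr_ge0 // mulr_ge0.
Qed.

Lemma lead_coef_curve : lead_coef curve = g * (lam ord_max)%:P.
Proof.
have N0 : N%N == 0%N = false by apply/negbTE; rewrite -lt0n degree_gt0.
rewrite lead_coefE size_curve /= coefB coefZ coefC N0 subr0 coef_map /=.
rewrite -(lead_coef_linearized p_prime e_gt0 q_def lam_r) lead_coefE.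
by rewrite (size_linearized p_prime e_gt0 q_def lam_r).
Qed.

(** * Expansions of the elements of the Riemann-Roch space *)

(** Over a place of [K(x)] where [g] does not vanish, the equation
    specializes to a separable polynomial of degree [q^r]. A nonzero polynomial of
    smaller degree thus misses one of its roots, and a simple root carries a
    place. *)
Lemma place_over_factor (pi : {poly K}) (U : {poly {poly K}}) k0 :
    irreducible_poly pi -> (forall i, coprimep pi (pg i)) ->
    (size U <= N)%N -> ~~ (pi %| U`_k0) ->
  exists2 P : place iota, 0 < P (ex pi) & exy U != 0 /\ P (exy U) = 0.
Proof.
move=> pi_irr pi_pg UN piU.
have pi0 := irredp_neq0 pi_irr.
have [L1 [j1 [rs1 split1]]] := finField_splitting pi0.
have [x1 x1_rs] : exists x1, x1 \in rs1.
  case: rs1 split1 => [|x1 rs1 _]; last by exists x1; rewrite mem_head.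
  rewrite big_nil => /eqp_size; rewrite size_map_poly size_poly1 => s1.
  by have := pi_irr.1; rewrite s1.
have pi_x1 : eval_at j1 x1 pi = 0.
  by apply/rootP; rewrite (eqp_root split1) root_prod_XsubC.
have nz1 A : coprimep pi A -> eval_at j1 x1 A != 0.
  move=> /Bezout_eq1_coprimepP[[u v] /= uv]; apply/eqP => A0.
  have := congr1 (eval_at j1 x1) uv; rewrite rmorphD !rmorphM /= pi_x1 A0 rmorph1.
  by rewrite !mulr0 addr0 => /eqP; rewrite eq_sym oner_eq0.
have g_x1 : eval_at j1 x1 g != 0.
  apply: nz1; rewrite (eqp_coprimepr _ g_fact).
  apply: (big_ind (fun A => coprimep pi A)) => [|A B|i _]; first exact: coprimep1.
    by rewrite coprimepMr => -> ->.
  by rewrite coprimep_expr.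
pose C1 := map_poly (eval_at j1 x1) curve.
have size_C1 : size C1 = N.+1.
  rewrite size_map_poly_id0 ?size_curve // lead_coef_curve rmorphM /= eval_atC.
  by rewrite mulf_neq0 // fmorph_eq0.
have C1_neq0 : C1 != 0 by rewrite -size_poly_gt0 size_C1.
have [L2 [j2 [rs2 split2]]] := finField_splitting C1_neq0.
pose j : {rmorphism K -> L2} := j2 \o j1.
have evE A : j2 (eval_at j1 x1 A) = eval_at j (j2 x1) A.
  by rewrite !eval_atE -horner_map -map_poly_comp.
have C1E : map_poly j2 C1 = map_poly (eval_at j (j2 x1)) curve.
  by rewrite /C1 -map_poly_comp; apply: eq_map_poly => A /=; rewrite evE.
have C1' : C1^`() = (eval_at j1 x1 g * j1 (lam ord0))%:P.
  by rewrite deriv_map deriv_curve map_polyC /= rmorphM /= eval_atC.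
have uniq_rs2 : uniq rs2.
  rewrite -separable_prod_XsubC -(eqp_separable split2) separable_map.
  rewrite separable_poly.unlock C1' -alg_polyC coprimepZr ?coprimep1 //.
  by rewrite mulf_neq0 // fmorph_eq0.
have size_rs2 : size rs2 = N.
  have := eqp_size split2; rewrite size_map_poly size_C1 size_prod_XsubC.
  by case.
pose U2 := map_poly (eval_at j (j2 x1)) U.
have U2_neq0 : U2 != 0.
  apply/eqP => U20; have := congr1 (fun A : {poly L2} => A`_k0) U20.
  rewrite coef0 coef_map /= -evE => /eqP; rewrite fmorph_eq0.
  by apply/negP/nz1; rewrite irreducible_poly_coprime.
have : ~~ all (root U2) rs2.
  apply/negP => all_root; have := max_poly_roots U2_neq0 all_root uniq_rs2.
  by rewrite size_rs2 ltnNge (leq_trans (size_poly _ _) UN).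
case/allPn => y0 y0_rs U2y0.
have [||P PE] := @place_at_point K F iota x y x_transc F_gen N curve size_curve
  curve_root free_powers_y L2 j (j2 x1) y0.
- by apply/rootP; rewrite -C1E (eqp_root split2) root_prod_XsubC.
- rewrite deriv_curve eval_atC /= rmorphM /= eval_atC -evE.
  by rewrite mulf_neq0 ?fmorph_eq0.
have U0 : U != 0 by apply: contraNneq piU => ->; rewrite coef0 dvdp0.
have exyU := free_powers_y UN U0.
exists P; last first.
  have [PU1 PU2] := PE U exyU; split=> //; apply/eqP; rewrite eq_le PU1 leNgt PU2.
  by rewrite andbT; exact: U2y0.
have := PE pi%:P; rewrite eval_atC => /(_ (ex_neq0 pi0)) [_ ->].
by rewrite eval_atC /= -evE pi_x1 rmorph0.
Qed.

Lemma prod_pg_poly (m : 'I_s -> int) : (forall i, 0 <= m i) ->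
  \prod_(i < s) ex (pg i) ^ m i = ex (\prod_(i < s) pg i ^+ `|m i|%N).
Proof.
move=> m0; rewrite rmorph_prod; apply: eq_bigr => i _.
by rewrite rmorphXn /= exprnP gez0_abs.
Qed.

Lemma prod_pgD (m m' : 'I_s -> int) :
  \prod_(i < s) ex (pg i) ^ m i * \prod_(i < s) ex (pg i) ^ m' i =
  \prod_(i < s) ex (pg i) ^ (m i + m' i).
Proof.
rewrite -big_split; apply: eq_bigr => i _ /=.
by rewrite expfzDr // ex_neq0 // pg_neq0.
Qed.

(** Multiplication by a high power of [\prod_i pg i] passes from the basis
    [w k] to the powers of [y] and back, with coefficients in [K[x]] that have no
    other prime factors than the [pg i]. *)
Lemma clear_denominators : exists Z : {poly K}, exists2 E : nat -> {poly K},
  (forall A, (forall i, coprimep A (pg i)) -> coprimep A Z /\ forall k, coprimep A (E k)) &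
  [/\ Z != 0, forall k : 'I_N, w k * ex Z = y ^+ k * ex (E k) &
    exists E' : nat -> {poly K}, forall k : 'I_N, y ^+ k * ex Z = w k * ex (E' k)].
Proof.
pose M : nat := (\sum_(k < N) \sum_(i < s) `|alpha k i|%N)%N.
have M_ge (k : 'I_N) i : `|alpha k i|%N%:Z <= M%:Z.
  by rewrite lez_nat /M (bigD1 k) //= (bigD1 i) //= -addnA leq_addr.
pose Z := \prod_(i < s) pg i ^+ M.
have ZE : ex Z = \prod_(i < s) ex (pg i) ^ M%:Z.
  by rewrite prod_pg_poly.
have cop_prod A (m : 'I_s -> nat) : (forall i, coprimep A (pg i)) ->
    coprimep A (\prod_(i < s) pg i ^+ m i).
  move=> Ag; apply: (big_ind (fun B => coprimep A B)) => [|B C|i _].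
  - exact: coprimep1.
  - by rewrite coprimepMr => -> ->.
  by rewrite coprimep_expr.
exists Z, (fun k => \prod_(i < s) pg i ^+ absz (M%:Z - alpha k i)).
  by move=> A Ag; split=> [|k]; apply: cop_prod.
split; first by rewrite prodf_seq_neq0; apply/allP => i _; rewrite expf_neq0 ?pg_neq0.
  move=> k; rewrite ZE -mulrA prod_pgD -prod_pg_poly => [|i].
    by congr (_ * _); apply: eq_bigr => i _; rewrite addrC.
  by have := M_ge k i; move: (alpha k i) M%:Z => u v; clear; lia.
exists (fun k => \prod_(i < s) pg i ^+ absz (M%:Z + alpha k i)) => k.
rewrite ZE -prod_pg_poly => [|i]; last first.
  by have := M_ge k i; move: (alpha k i) M%:Z => u v; clear; lia.
rewrite -mulrA prod_pgD; congr (_ * _); apply: eq_bigr => i _.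
by congr (_ ^ _); ring.
Qed.

Section Span.
Variables (z : F) (z_neq0 : z != 0).
Hypothesis z_G : forall P : place iota, - coeff P G <= P z.

Let expands D (C : 'I_N -> {poly K}) := z * ex D = \sum_(k < N) w k * ex (C k).

Let exists_expansion : exists2 D, D != 0 & exists C, expands D C.
Proof.
have [D [U [D0 UN zE]]] := representation z.
have [Z [E _ [Z0 _ [E' E'E]]]] := clear_denominators.
exists (D * Z); first by rewrite mulf_neq0.
exists (fun k => U`_k * E' k); rewrite /expands rmorphM mulrA zE (eval_at_sum _ _ UN).
rewrite mulr_suml; apply: eq_bigr => k _.
by rewrite -mulrA E'E rmorphM mulrCA.
Qed.

(** The terms of the expansion have distinct values at [P], so none of
    them is smaller than the value of the left-hand side. *)
Let expansion_term_ge (delta : nat) (P : place iota) D C k :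
    coprime N delta -> P y = - delta%:Z ->
    (forall A, A != 0 -> (N%:Z %| P (ex A))%Z) ->
    expands D C -> D != 0 -> C k != 0 ->
  P z + P (ex D) <= P (w k) + P (ex (C k)).
Proof.
move=> cop Py P_ex DC D0 Ck.
pose c (l : 'I_N) := \prod_(i < s) ex (pg i) ^ (- alpha l i) * ex (C l).
have wE (l : 'I_N) : w l * ex (C l) = c l * y ^+ l by rewrite /c /scaled_power; ring.
have Cx := ex_neq0 Ck.
have ck : c k != 0 by rewrite mulf_neq0 // prod_pg_neq0.
have c_N l : c l != 0 -> (N%:Z %| P (c l))%Z.
  rewrite mulf_eq0 negb_or => /andP[pl Cl].
  have Cl0 : C l != 0 by apply: contraNneq Cl => ->; rewrite rmorph0.
  rewrite place_valM // place_val_prod_pg rpredD ?P_ex // rpred_sum // => i _.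
  by rewrite dvdz_mull // P_ex // pg_neq0.
have N0 := degreeZ_gt0.
have NPy : N%:Z * P y = - (delta%:Z * N%:Z) by rewrite Py mulrN mulrC.
have [_ + _] := ramified_val_sum N0 degree_gt0 cop NPy y_neq0 c_N ck.
rewrite -(eq_bigr _ (fun l _ => wE l)) -DC -wE.
by rewrite (place_valM P z_neq0 (ex_neq0 D0)) (place_valM P (scaled_power_neq0 k) Cx).
Qed.

(* The value of [z] at [Q i] leaves no room for a pole of the quotient [C k / D]
   at [pg i]: the exponent [alpha k i] is already the largest possible. *)
Let pg_dvd_coef i D C : expands D C -> D != 0 -> pg i %| D ->
  forall k, pg i %| C k.
Proof.
move=> DC D0 /dvdpP[D' DE] k; apply: contraT => piC.
have Ck : C k != 0 by apply: contraNneq piC => ->; rewrite dvdp0.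
have [w_ wE] := place_val_eval_zero x_transc (pg_irr i).
have [Qpi Qy] := Q_ramified i.
have Q_ex A : A != 0 -> (N%:Z %| Q i (ex A))%Z.
  by move=> A0; rewrite (wE (Q i)) ?Qpi ?dvdz_mull // degreeZ_gt0.
have := expansion_term_ge (coprime_degree (ng_coprime i)) Qy Q_ex DC D0 Ck.
have QC : Q i (ex (C k)) = 0.
  apply: (@place_val_eval_coprime _ _ _ _ _ (pg i)); first exact: (Q_zero i).2.
  by rewrite irreducible_poly_coprime.
have D'0 : D' != 0 by apply: contraNneq D0 => D'0; rewrite DE D'0 mul0r.
rewrite QC Q_scaled_power DE rmorphM place_valM ?ex_neq0 ?pg_neq0 // Qpi.
have := val_ge_eval D' (Q_x i); rewrite val_geE ?ex_neq0 //.
have := z_G (Q i); rewrite coeff_G_Q.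
have /andP[_] := floorP (a i - k%:Z * (ng i)%:Z); rewrite -/(alpha k i).
move: (Q i z) (Q i (ex D')) (alpha k i) N%:Z (k%:Z * _) => u v al M t; clear; lia.
Qed.

(* Otherwise some place above [pi] is a zero of [D] but not of the right-hand
   side, so it is a pole of [z] that [G] does not allow. *)
Let prime_dvd_coef pi D C : irreducible_poly pi -> (forall i, coprimep pi (pg i)) ->
  expands D C -> D != 0 -> pi %| D -> forall k, pi %| C k.
Proof.
move=> pi_irr pi_pg DC D0 /dvdpP[D' DE] k; apply: contraT => piC.
have [Z [E /(_ pi pi_pg)[cZ cE] [Z0 wE _]]] := clear_denominators.
pose U : {poly {poly K}} := \poly_(l < N) (if insub l is Some l' then C l' * E l else 0).
have Uk (l : 'I_N) : U`_l = C l * E l.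
  by rewrite coef_poly ltn_ord valK.
have [|P Ppi [U0 PU]] := @place_over_factor pi U k pi_irr pi_pg (size_poly _ _).
  rewrite Uk; apply: contra piC => piCE.
  by rewrite -(Gauss_dvdpl _ (cE k)).
have UE : exy U = z * ex D * ex Z.
  rewrite (eval_at_sum _ _ (size_poly _ _)) DC mulr_suml; apply: eq_bigr => l _.
  by rewrite -/U Uk rmorphM [RHS]mulrAC wE; ring.
have PZ : P (ex Z) = 0 by exact: place_val_eval_coprime Ppi cZ.
have Px := place_val_x_ge0 Ppi.
have D'0 : D' != 0 by apply: contraNneq D0 => D'0; rewrite DE D'0 mul0r.
have := val_ge_eval D' Px; rewrite val_geE ?ex_neq0 // => PD'.
have Pg i : P (ex (pg i)) = 0 by exact: place_val_eval_coprime Ppi (pi_pg i).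
have := z_G P; rewrite coeff_G_other // oppr0 => Pz.
move: PU; rewrite UE !place_valM ?mulf_neq0 ?ex_neq0 // PZ DE rmorphM.
rewrite place_valM ?ex_neq0 ?(irredp_neq0 pi_irr) //; move: Pz PD' Ppi.
by move: (P z) (P (ex D')) (P (ex pi)) => u v t; clear; lia.
Qed.

(* A denominator of minimal degree is constant, as each of its prime factors
   would divide all numerators. *)
Let integral_expansion : exists C, expands 1 C.
Proof.
have [D D0 [C DC]] := exists_expansion.
have [n] := ubnP (size D); elim: n D D0 C DC => // n IH D D0 C DC sD.
have [sD1|sD1] := leqP (size D) 1.
  have [c c0 DE] : exists2 c, c != 0 & D = c%:P.
    by have := D0; rewrite (size1_polyC sD1) polyC_eq0 => c0; exists D`_0.
  exists (fun k => c^-1%:P * C k); rewrite /expands rmorph1 mulr1.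
  apply: (mulIf (ex_neq0 D0)); rewrite [LHS]DC mulr_suml; apply: eq_bigr => k _.
  by rewrite rmorphM DE /= !eval_atC fmorphV; field; rewrite fmorph_eq0.
have [pi pi_irr piD] := irreducible_factor sD1.
have piC k : pi %| C k.
  have [copi|] := pselect (forall i, coprimep pi (pg i)).
    exact: prime_dvd_coef pi_irr copi DC D0 piD k.
  move=> /existsNP[i]; rewrite irreducible_poly_coprime // => /negP/negPn pi_pg.
  have pi_eq : pi %= pg i.
    by apply: (pg_irr i).2 => //; rewrite neq_ltn pi_irr.1 orbT.
  rewrite (eqp_dvdl _ pi_eq); apply: pg_dvd_coef DC D0 _ k.
  by rewrite -(eqp_dvdl _ pi_eq).
have /dvdpP[D' DE] := piD.
have /choice[C' CE] : forall k, exists C', C k = C' * pi by move=> k; apply/dvdpP.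
have D'0 : D' != 0 by apply: contraNneq D0 => D'0; rewrite DE D'0 mul0r.
apply: (IH D' D'0 C').
  rewrite /expands; apply: (mulIf (ex_neq0 (irredp_neq0 pi_irr))).
  rewrite -mulrA -rmorphM -DE DC mulr_suml; apply: eq_bigr => k _.
  by rewrite CE rmorphM mulrA.
move: sD; rewrite DE size_mul ?(irredp_neq0 pi_irr) //; have := pi_irr.1.
by move: (size D') (size pi) => u v; clear; lia.
Qed.

(** The degrees are read off at [Qinf], where no cancellation occurs. *)
Lemma riemann_roch_expansion : exists2 B : 'I_N -> {poly K},
  forall k : 'I_N, (size (B k))%:Z <= Num.max (bound k) 0 &
  z = \sum_(k < N) w k * ex (B k).
Proof.
have [C zC] := integral_expansion; exists C; last first.
  by have := zC; rewrite /expands rmorph1 mulr1.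
move=> k; rewrite le_max.
have [->|Ck] := eqVneq (C k) 0; first by rewrite size_poly0 orbT.
have [Qx Qy] := Qinf_ramified.
have Q_ex A : A != 0 -> (N%:Z %| Qinf (ex A))%Z.
  by move=> A0; rewrite Qinf_ex // rpredN dvdz_mull.
have := expansion_term_ge (coprime_degree d_coprime) Qy Q_ex zC (oner_neq0 _) Ck.
rewrite rmorph1 place_val1 addr0 Qinf_scaled_power Qinf_ex //.
have := z_G Qinf; rewrite coeff_G_Qinf.
have /andP[_] := floorP (b - k%:Z * d%:Z); rewrite -/(beta k).
have := size_poly_gt0 (C k); rewrite Ck => sC h1 h2 h3; apply/orP; left.
have : 0 < (bound k - (size (C k)).-1%:Z) * N%:Z.
  move: h1 h2 h3; move: (bound k) (beta k) (size (C k)).-1%:Z N%:Z (Qinf z) (k%:Z * _).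
  by move=> u v t M o l; clear; lia.
rewrite pmulr_lgt0 ?degreeZ_gt0 // subr_gt0; move: sC (bound k).
by case: (size (C k)) => // l _ u /=; clear; lia.
Qed.

End Span.

(** * The basis of the Riemann-Roch space *)

Definition len (k : nat) : nat := `|Num.max (bound k) 0|%N.

Lemma lenE k : (len k)%:Z = Num.max (bound k) 0.
Proof. by rewrite gez0_abs // le_max lexx orbT. Qed.

Definition basis_index := {k : 'I_N & 'I_(len k)}.

Definition index_at (k : 'I_N) (j : 'I_(len k)) : basis_index :=
  Tagged (fun k : 'I_N => 'I_(len k)) j.

Definition basis (i : basis_index) : F := w (tag i) * x ^+ tagged i.

Lemma card_basis_index : #|{: basis_index}|%:Z = \sum_(0 <= k < N) Num.max (bound k) 0.
Proof.
rewrite card_tagged sumnE big_map big_enum big_mkord /=.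
rewrite (big_morph Posz PoszD (erefl _)); apply: eq_bigr => k _.
by rewrite card_ord lenE.
Qed.

Lemma sum_basis (c : basis_index -> K) :
  \sum_i iota (c i) * basis i =
  \sum_(k < N) w k * \sum_(j < len k) iota (c (index_at j)) * x ^+ j.
Proof.
under [RHS]eq_bigr do rewrite mulr_sumr.
rewrite sig_big_dep /=; apply: eq_bigr => -[k j] _.
by rewrite /basis /= mulrCA.
Qed.

Lemma eval_coefs (k : 'I_N) (B : {poly K}) : (size B <= len k)%N ->
  ex B = \sum_(j < len k) iota B`_j * x ^+ j.
Proof. exact: eval_at_sum. Qed.

(** Clearing denominators reduces this to the independence of the powers of [y]. *)
Lemma scaled_power_free (B : nat -> {poly K}) :
  \sum_(k < N) w k * ex (B k) = 0 -> forall k : 'I_N, B k = 0.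
Proof.
move=> sum0 k; have [Z [E _ [Z0 wE _]]] := clear_denominators.
have Ek : E k != 0.
  apply: contraTneq (mulf_neq0 (scaled_power_neq0 k) (ex_neq0 Z0)) => E0.
  by rewrite wE E0 rmorph0 mulr0 eqxx.
pose U : {poly {poly K}} := \poly_(l < N) (E l * B l).
have U0 : exy U = 0.
  transitivity ((\sum_(l < N) w l * ex (B l)) * ex Z); last by rewrite sum0 mul0r.
  rewrite (eval_at_sum _ _ (size_poly _ _)) mulr_suml.
  apply: eq_bigr => l _; rewrite coef_poly ltn_ord rmorphM [RHS]mulrAC wE; ring.
have : U`_k = 0.
  have [->|/(free_powers_y (size_poly _ _))] := eqVneq U 0; first by rewrite coef0.
  by rewrite -/U U0 eqxx.
by rewrite coef_poly ltn_ord => /eqP; rewrite mulf_eq0 (negPf Ek) => /eqP.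
Qed.

Lemma basis_free (c : basis_index -> K) :
  \sum_i iota (c i) * basis i = 0 -> forall i, c i = 0.
Proof.
rewrite sum_basis => sum0.
pose B (k : 'I_N) : {poly K} := rVpoly (\row_(j < len k) c (index_at j)).
have coefB (k : 'I_N) (j : 'I_(len k)) : (B k)`_j = c (index_at j).
  by rewrite coef_rVpoly_ord mxE.
case=> k j; rewrite -[existT _ k j]/(index_at j) -coefB.
pose B' (l : nat) : {poly K} := if insub l is Some l' then B l' else 0.
have B'E (l : 'I_N) : B' l = B l by rewrite /B' valK.
suff -> : B k = 0 by rewrite coef0.
rewrite -B'E; apply: scaled_power_free; rewrite -[RHS]sum0; apply: eq_bigr => l _.
rewrite B'E (@eval_coefs l) ?size_poly //; congr (_ * _); apply: eq_bigr => i _.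
by rewrite coefB.
Qed.

Lemma basis_span z : riemann_roch G z <->
  exists c : basis_index -> K, z = \sum_i iota (c i) * basis i.
Proof.
split=> [|[c ->]].
  case=> [[z0 z_G]|->]; last first.
    by exists (fun _ => 0); rewrite big1 // => i _; rewrite rmorph0 mul0r.
  have [B sB ->] := riemann_roch_expansion z0 z_G.
  exists (fun i : basis_index => (B (tag i))`_(nat_of_ord (tagged i))); rewrite sum_basis.
  apply: eq_bigr => k _; congr (_ * _); apply: eval_coefs.
  by rewrite -lez_nat lenE.
set z' := (X in riemann_roch _ X); have [->|z'0] := eqVneq z' 0; first by right; exact: erefl.
left; split=> // P; rewrite -val_geE // /z' sum_basis; apply: val_ge_sum => k _.
pose B : {poly K} := rVpoly (\row_(j < len k) c (index_at j)).
rewrite [X in _ * X](_ : _ = ex B); last first.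
  rewrite (@eval_coefs k) ?size_poly //; apply: eq_bigr => j _.
  by rewrite coef_rVpoly_ord mxE.
by apply: val_ge_basis; rewrite -lenE lez_nat size_poly.
Qed.

End LinearizedFunctionField.

Lemma has_dim_fintype (K F : fieldType) (iota : {rmorphism K -> F}) (I : finType)
    (v : I -> F) (V : set F) :
    (forall c : I -> K, \sum_i iota (c i) * v i = 0 -> forall i, c i = 0) ->
    (forall z, V z <-> exists c : I -> K, z = \sum_i iota (c i) * v i) ->
  has_dim iota V #|I|.
Proof.
move=> v_free v_span; exists (fun i => v (enum_val i)).
have sumE (c : I -> K) : \sum_i iota (c i) * v i =
    \sum_(i < #|I|) iota (c (enum_val i)) * v (enum_val i).
  by rewrite (reindex (@enum_val I predT)) //; exact: onW_bij (enum_val_bij I).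
have rankK (c : 'I_#|I| -> K) : c =1 (fun i => c (enum_rank (enum_val i))).
  by move=> i; rewrite enum_valK.
split=> [c c0 i|z].
  rewrite rankK; apply: (v_free (fun j => c (enum_rank j))); rewrite sumE -[RHS]c0.
  by apply: eq_bigr => l _; rewrite -rankK.
rewrite v_span; split=> [] [c ->].
  by exists (fun i => c (enum_val i)); rewrite sumE.
exists (fun j => c (enum_rank j)); rewrite sumE.
by apply: eq_bigr => l _; rewrite -rankK.
Qed.

Theorem theorem3p4
  (p e q n r : nat) (p_prime : prime p) (e_gt0 : (0 < e)%N)
  (q_def : q = (p ^ e)%N) (n_gt0 : (0 < n)%N)
  (K : finFieldType) (card_K : #|K| = (q ^ n)%N)
  (lam : 'I_r.+1 -> K) (lam_r : lam ord_max != 0) (lam_0 : lam ord0 != 0)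
  (L_roots : #|[set a : K | root (linearized_poly q lam) a]%SET| = (q ^ r)%N)
  (f g : {poly K}) (cop_fg : coprimep f g)
  (m : nat) (qf : 'I_m -> {poly K}) (mf : 'I_m -> nat)
  (qf_irr : forall j, irreducible_poly (qf j))
  (qf_distinct : forall j1 j2, j1 != j2 -> ~~ (qf j1 %= qf j2))
  (mf_gt0 : forall j, (0 < mf j)%N)
  (f_fact : f %= \prod_(j < m) qf j ^+ mf j)
  (s : nat) (pg : 'I_s -> {poly K}) (ng : 'I_s -> nat)
  (pg_irr : forall i, irreducible_poly (pg i))
  (pg_distinct : forall i1 i2, i1 != i2 -> ~~ (pg i1 %= pg i2))
  (ng_gt0 : forall i, (0 < ng i)%N)
  (g_fact : g %= \prod_(i < s) pg i ^+ ng i)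
  (d : nat) (d_def : d%:Z = (size f).-1%:Z - (size g).-1%:Z) (d_gt0 : (0 < d)%N)
  (ng_coprime : forall i, coprime (ng i) p) (d_coprime : coprime d p)
  (F : fieldType) (iota : {rmorphism K -> F}) (x y : F)
  (x_transc : ~ algebraicOver iota x)
  (F_gen : generated_by2 iota x y)
  (y_eq : (map_poly iota (linearized_poly q lam)).[y]
          = (map_poly iota f).[x] / (map_poly iota g).[x])
  (Q : 'I_s -> place iota) (Qinf : place iota)
  (Q_zero : forall i, zero_of (Q i) (map_poly iota (pg i)).[x])
  (Qinf_pole : pole_of Qinf x)
  (a : 'I_s -> int) (b : int) :
  let G : {freeg (place iota) / int} :=
    \sum_(i < s) << a i *g Q i >> + << b *g Qinf >> in
  exists2 l : nat, has_dim iota (riemann_roch G) l &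
    l%:Z = \sum_(0 <= k < (q ^ r)%N)
      Num.max
        (\sum_(i < s)
            ((a i - k%:Z * (ng i)%:Z) %/ (q ^ r)%N%:Z)%Z * (size (pg i)).-1%:Z
          + ((b - k%:Z * d%:Z) %/ (q ^ r)%N%:Z)%Z + 1)
        0.
Proof.
have charK : p \in [pchar K].
  by apply: (@card_finPcharP _ p (e * n)) => //; rewrite card_K q_def expnM.
move=> G; exists #|{: basis_index q r pg ng d a b}|.
  apply: has_dim_fintype.
    by apply: (@basis_free p e q r K lam) => //; eassumption.
  by move=> z; apply: (@basis_span p e q r K lam) => //; eassumption.
exact: card_basis_index.
Qed.
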